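(* Let $\mathbf{b}\in\mathbb{C}^n\setminus\{0\}$ and let $L:\mathbb{B}_n\to\mathbb{R}_+$ be continuous with $L(z)>\frac{\beta|\mathbf{b}|}{1-|z|}$ for all $z\in\mathbb{B}_n$, where $\beta>1$ is a constant. Suppose that for every $z^0\in\mathbb{B}_n$ and $\theta\in[0,2\pi]$ the function $r\mapsto L(z^0+re^{i\theta}\mathbf{b})$ is a continuously differentiable function of the real variable $r\in[0,R)$, where $R=R(z^0,\theta)=\min\{t\in\mathbb{R}_+:|z^0+te^{i\theta}\mathbf{b}|=1\}$. If an analytic in $\mathbb{B}_n$ function $F$ is of bounded $L$-index in the direction $\mathbf{b}$ and $N=N_{\mathbf{b}}(F,L)$, then for every $z^0\in\mathbb{B}_n$, $\theta\in[0,2\pi]$, $r\in[0,R)$ and every integer $p\ge0$ $$\ln\left(\frac{1}{p!L^p(z^0+re^{i\theta}\mathbf{b})}\left|\frac{\partial^pF(z^0+re^{i\theta}\mathbf{b})}{\partial\mathbf{b}^p}\right|\right)\le\ln\max\left\{\frac{1}{k!L^k(z^0)}\left|\frac{\partial^kF(z^0)}{\partial\mathbf{b}^k}\right|:0\le k\le N\right\}$$ $$+\int_0^r\left\{(N+1)L(z^0+te^{i\theta}\mathbf{b})+N\frac{(-L'_t(z^0+te^{i\theta}\mathbf{b}))^+}{L(z^0+te^{i\theta}\mathbf{b})}\right\}dt.$$ If, in addition, for every $z^0\in\mathbb{B}_n$ $$\frac{\big(-L'_r(z^0+re^{i\theta}\mathbf{b})\big)^+}{L^2(z^0+re^{i\theta}\mathbf{b})}\to0\quad\text{as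 } |z^0+re^{i\theta}\mathbf{b}|\to1,$$ uniformly in $\theta\in[0,2\pi]$, then for every $z^0\in\mathbb{B}_n$ and $\theta\in[0,2\pi]$ $$\limsup_{|z^0+re^{i\theta}\mathbf{b}|\to1}\frac{\ln|F(z^0+re^{i\theta}\mathbf{b})|}{\int_0^rL(z^0+te^{i\theta}\mathbf{b})\,dt}\le N_{\mathbf{b}}(F,L)+1.$$
   Context: $|\cdot|$ is the Euclidean norm on $\mathbb{C}^n$, $\mathbb{B}_n=\{z\in\mathbb{C}^n:|z|<1\}$, $\mathbb{R}_+=(0,\infty)$, $\mathbb{Z}_+=\{0,1,2,\dots\}$, $a^+=\max\{a,0\}$, and $\ln0=-\infty$. $L'_t(z^0+te^{i\theta}\mathbf{b})$ denotes the derivative of the real function $t\mapsto L(z^0+te^{i\theta}\mathbf{b})$ (and $L'_r$ the same with $r$ in place of $t$). The limits as $|z^0+re^{i\theta}\mathbf{b}|\to1$ are taken with $r\in[0,R)$, i.e. as $r\to R$. Directional derivatives: $\frac{\partial^0F}{\partial\mathbf{b}^0}=F$, $\frac{\partial F}{\partial\mathbf{b}}=\sum_{j=1}^n\frac{\partial F}{\partial z_j}b_j$, $\frac{\partial^kF}{\partial\mathbf{b}^k}=\frac{\partial}{\partial\mathbf{b}}\big(\frac{\partial^{k-1}F}{\partial\mathbf{b}^{k-1}}\big)$ for $k\ge2$. An analytic function $F$ in $\mathbb{B}_n$ is of bounded $L$-index in the direction $\mathbf{b}$ if there is $m_0\in\mathbb{Z}_+$ such that for all $m\in\mathbb{Z}_+$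 and all $z\in\mathbb{B}_n$ $$\frac{1}{m!L^m(z)}\left|\frac{\partial^mF(z)}{\partial\mathbf{b}^m}\right|\le\max\left\{\frac{1}{k!L^k(z)}\left|\frac{\partial^kF(z)}{\partial\mathbf{b}^k}\right|:0\le k\le m_0\right\};$$ the least such $m_0$ is denoted $N_{\mathbf{b}}(F,L)$. *)

(* Defs.v *)
From HB Require Import structures.
From mathcomp Require Import all_boot all_order all_algebra finmap complex.
From mathcomp Require Import all_classical all_reals all_analysis.
From mathcomp.analysis.showcase Require Import summability.
Set Implicit Arguments.
Unset Strict Implicit.
Unset Printing Implicit Defensive.
Import Order.TTheory GRing.Theory Num.Theory.
Import numFieldNormedType.Exports.
Local Open Scope classical_set_scope.
Local Open Scope ring_scope.

(* R[i] with the topology of its modulus, as a normed space over itself, so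
   that 'D_v below is a complex derivative. *)
HB.instance Definition _ (R : rcfType) :=
  NormedModule.copy R[i] (R[i] : numClosedFieldType)^o.

(* The modulus as an element of R; the library norm would live in R[i]. *)
Definition cabs (R : realType) (x : R[i]) : R := ComplexField.Normc.normc x.

Section Defs.
Context {R : realType} {n : nat}.
Implicit Types (z w b : 'rV[R[i]]_n) (F : 'rV[R[i]]_n -> R[i])
  (L : 'rV[R[i]]_n -> R).

(* The library norm on 'rV[R[i]]_n is the sup norm; it defines the same
   topology as this one. *)
Definition enorm z : R := Num.sqrt (\sum_(j < n) cabs (z 0 j) ^+ 2).

Definition uball : set 'rV[R[i]]_n := [set z | enorm z < 1].

(* Functions on the unit ball are total functions whose values outside the
   ball are irrelevant. *)

(* F is locally the sum of a power series in n variables; the family of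
   monomials is summed over the directed set of finite sets of multi-indices
   (unordered, hence absolute, convergence). *)
Definition analytic_on (U : set 'rV[R[i]]_n) F : Prop :=
  forall z, U z ->
  exists (rho : R) (c : {ffun 'I_n -> nat} -> R[i]), 0 < rho /\
    forall w, enorm w < rho ->
      partial_sum (fun a : {ffun 'I_n -> nat} =>
        c a * \prod_(j < n) w 0 j ^+ a j) @ totally --> F (z + w).

Definition partialz (j : 'I_n) F z : R[i] := 'D_(delta_mx 0 j) F z.

Definition dderive b F z : R[i] := \sum_(j < n) partialz j F z * b 0 j.

Definition dderiven b (k : nat) F : 'rV[R[i]]_n -> R[i] :=
  iter k (dderive b) F.

Definition lcoef b F L (k : nat) z : R :=
  (k`!%:R * L z ^+ k)^-1 * cabs (dderiven b k F z).

(* The base value 0 of the iterated maximum is harmless: on the ball, where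
   L > 0, all the terms are nonnegative. *)
Definition max_lcoef b F L (m : nat) z : R :=
  \big[Num.max/0]_(k < m.+1) lcoef b F L k z.

Definition lindex_bound b F L (m0 : nat) : Prop :=
  forall (m : nat) z, uball z -> lcoef b F L m z <= max_lcoef b F L m0 z.

Definition bounded_lindex b F L : Prop := exists m0, lindex_bound b F L m0.

(* The least admissible m0 (0 by default if F is not of bounded L-index). *)
Definition lindex b F L : nat :=
  xget 0%N [set m0 | lindex_bound b F L m0 /\
    forall m, lindex_bound b F L m -> (m0 <= m)%N].

Definition ray z b (theta r : R) : 'rV[R[i]]_n :=
  z + (r%:C * (cos theta +i* sin theta))%C *: b.

(* R(z, theta) = min {t > 0 : |z + t e^(i theta) b| = 1}; the minimum exists
   when z is in the ball and b != 0. *)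
Definition exit_radius z b (theta : R) : R :=
  let A := [set t : R | 0 < t /\ enorm (ray z b theta t) = 1] in
  xget 0 (A `&` lbound A).

(* The usual two-sided derivative. At r = 0 with z in the ball it is still
   meaningful, since z + r e^(i theta) b stays in the ball for small r < 0. *)
Definition ray_derive L z b (theta r : R) : R :=
  derive1 (fun t : R => L (ray z b theta t)) r.

End Defs.

(* Continuously differentiable on I, the difference quotients being taken
   inside I: at a left endpoint of I this is the right derivative. *)
Definition C1_on (R : realType) (I : set R) (h : R -> R) : Prop :=
  exists2 g : R -> R, {within I, continuous g} &
    forall t, I t -> (h s - h t) / (s - t) @[s --> within I t^'] --> g t.

Definition pospart (R : realType) (a : R) : R := Num.max a 0.

(* Main.v *)
(** Along a ray write D_k(t) for the k-th directional derivative of F at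
    z0 + t e^(i theta) b and l(t) for L at the same point. Each |D_k| grows at a
    rate at most |D_(k+1)|, and bounded index controls D_(N+1) by the first N + 1
    normalised coefficients |D_k| / (k! l^k); so their maximum grows at a
    logarithmic rate at most (N + 1) l + N (-l')^+ / l, and Gronwall's argument
    gives the first estimate. For the second, (-l')^+ / l is eventually at most
    eps l, and the integral of l diverges because l(t) >= c / (R - t).

    The growth of |D_k| requires that directional derivatives of F exist and are
    analytic. On a line each monomial of a power series is a polynomial whose
    coefficients are dominated by those of a product of real affine polynomials;
    this yields the first order Taylor estimate for the sum of the series. *)

Require Import Defs.
From HB Require Import structures.
From mathcomp Require Import all_boot all_order all_algebra finmap complex.
From mathcomp Require Import all_classical all_reals all_analysis.
From mathcomp.analysis.showcase Require Import summability.
From mathcomp Require Import ring lra.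
Set Implicit Arguments.
Unset Strict Implicit.
Unset Printing Implicit Defensive.
Import Order.TTheory GRing.Theory Num.Theory.
Import numFieldNormedType.Exports.
Local Open Scope classical_set_scope.
Local Open Scope ring_scope.

(** * Unordered sums of complex families *)

Section cabs.
Context {R : realType}.
Implicit Types x y : R[i].

Lemma cabsE x : `|x| = (cabs x)%:C%C.
Proof. by rewrite normc_def; case: x. Qed.

Lemma cabs_ge0 x : 0 <= cabs x.
Proof. by case: x => u v; exact: sqrtr_ge0. Qed.

Lemma cabs0 : cabs (0 : R[i]) = 0.
Proof. exact: ComplexField.Normc.normc0. Qed.

Lemma cabs1 : cabs (1 : R[i]) = 1.
Proof. exact: ComplexField.Normc.normc1. Qed.

Lemma cabs_eq0 x : cabs x = 0 -> x = 0.
Proof. exact: ComplexField.Normc.eq0_normc. Qed.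

Lemma cabsM x y : cabs (x * y) = cabs x * cabs y.
Proof. exact: ComplexField.Normc.normcM. Qed.

Lemma cabsN x : cabs (- x) = cabs x.
Proof. exact: normcN. Qed.

Lemma ler_cabsD x y : cabs (x + y) <= cabs x + cabs y.
Proof. exact: le_normcD. Qed.

Lemma ler_cabsB x y : cabs (x - y) <= cabs x + cabs y.
Proof. by rewrite -(cabsN y) ler_cabsD. Qed.

Lemma cabsX x k : cabs (x ^+ k) = cabs x ^+ k.
Proof.
by elim: k => [|k IH]; rewrite ?expr0 ?cabs1// !exprS cabsM IH.
Qed.

Lemma cabs_prod (I : Type) (s : seq I) (P : pred I) (f : I -> R[i]) :
  cabs (\prod_(i <- s | P i) f i) = \prod_(i <- s | P i) cabs (f i).
Proof.
exact: (big_morph (@cabs R) cabsM cabs1).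
Qed.

Lemma ler_cabs_sum (I : Type) (s : seq I) (P : pred I) (f : I -> R[i]) :
  cabs (\sum_(i <- s | P i) f i) <= \sum_(i <- s | P i) cabs (f i).
Proof.
elim/big_ind2: _ => [|u x v y h k|//]; first by rewrite cabs0.
by rewrite (le_trans (ler_cabsD _ _))// lerD.
Qed.

Lemma cabs_real (u : R) : cabs u%:C%C = `|u|.
Proof. by rewrite /cabs /= expr0n addr0 sqrtr_sqr. Qed.

Lemma cabs_sqr x : cabs x ^+ 2 = complex.Re x ^+ 2 + complex.Im x ^+ 2.
Proof. by case: x => u v; rewrite /cabs /= sqr_sqrtr// addr_ge0// sqr_ge0. Qed.

Lemma ler_Re_cabs x : `|complex.Re x| <= cabs x.
Proof.
by rewrite -ler_sqr ?nnegrE ?cabs_ge0// real_normK ?num_real// cabs_sqr lerDl sqr_ge0.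
Qed.

Lemma ler_Im_cabs x : `|complex.Im x| <= cabs x.
Proof.
by rewrite -ler_sqr ?nnegrE ?cabs_ge0// real_normK ?num_real// cabs_sqr lerDr sqr_ge0.
Qed.

Lemma ler_cabs_ReIm x : cabs x <= `|complex.Re x| + `|complex.Im x|.
Proof.
rewrite -ler_sqr ?nnegrE ?cabs_ge0// ?addr_ge0// cabs_sqr sqrrD.
rewrite !real_normK ?num_real// addrAC lerDl.
by rewrite mulrn_wge0// mulr_ge0.
Qed.

(** The library norm takes values in [R[i]], where a positive element has zero imaginary part, so
    real tolerances suffice. *)
Lemma pcvgP (T : Type) (G : set_system T) (f : T -> R[i]) (l : R[i]) :
  Filter G ->
  f @ G --> l <-> forall e : R, 0 < e -> \forall x \near G, cabs (l - f x) < e.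
Proof.
move=> FG; split=> [/cvgrPdist_lt H e e0|H].
  have /H : 0 < e%:C%C by rewrite -[0]/(0%:C%C) ltcR.
  by apply: filterS => x; rewrite cabsE ltcR.
apply/cvgrPdist_lt => e; rewrite ltcE => /andP[/eqP /= ei er].
have := H _ er; apply: filterS => x; rewrite cabsE ltcE /= ei eqxx /=; done.
Qed.

End cabs.

Section usum.
#[local] Existing Instance totally_filter.
Context {R : realType}.
Local Open Scope fset_scope.
Local Open Scope ring_scope.

Definition usum (I : choiceType) (f : I -> R[i]) (l : R[i]) : Prop :=
  (partial_sum f @ totally --> l)%classic.

Lemma partial_sumE (I : choiceType) (V : zmodType) (f : I -> V) (A : {fset I}) :
  partial_sum f A = \sum_(i <- A) f i.
Proof. by rewrite /partial_sum (big_seq_fsetE _ A xpredT f). Qed.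

Lemma usumP (I : choiceType) (f : I -> R[i]) l :
  usum f l <-> forall e : R, 0 < e -> exists A : {fset I}, forall B : {fset I},
    A `<=` B -> cabs (l - \sum_(i <- B) f i) < e.
Proof.
rewrite /usum pcvgP; split=> H e e0; have := H e e0.
  by case=> A _ AH; exists A => B AB; have := AH B AB; rewrite /= partial_sumE.
case=> A AH; exists A => // B AB; rewrite /= partial_sumE; exact: AH.
Qed.

Lemma usum_unique (I : choiceType) (f : I -> R[i]) a b :
  usum f a -> usum f b -> a = b.
Proof. by move=> fa fb; apply: cvg_unique fa fb => //; exact: norm_hausdorff. Qed.

Lemma usumD (I : choiceType) (f g : I -> R[i]) a b :
  usum f a -> usum g b -> usum (fun i => f i + g i) (a + b).
Proof.
move=> fa gb; rewrite /usum.
rewrite (_ : partial_sum _ = (fun A => partial_sum f A + partial_sum g A)).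
  exact: (cvgD fa gb).
by apply/funext => A; rewrite /partial_sum big_split.
Qed.

Lemma usumZ (I : choiceType) (f : I -> R[i]) c a :
  usum f a -> usum (fun i => c * f i) (c * a).
Proof.
move=> fa; rewrite /usum.
rewrite (_ : partial_sum _ = (fun A => c * partial_sum f A)).
  exact: (cvgM (cvg_cst c) fa).
by apply/funext => A; rewrite /partial_sum mulr_sumr.
Qed.

Lemma usum0 (I : choiceType) : usum (fun _ : I => 0 : R[i]) 0.
Proof.
rewrite /usum (_ : partial_sum _ = fun=> 0); first exact: cvg_cst.
by apply/funext => A; rewrite /partial_sum big1.
Qed.

Lemma usum_sum (I : choiceType) (J : Type) (s : seq J) (f : J -> I -> R[i]) a :
  (forall j, usum (f j) (a j)) ->
  usum (fun i => \sum_(j <- s) f j i) (\sum_(j <- s) a j).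
Proof.
move=> H; elim: s => [|j s IH].
  rewrite big_nil (_ : (fun i => _) = fun=> 0); first exact: usum0.
  by apply/funext => i; rewrite big_nil.
rewrite big_cons (_ : (fun i => _) = fun i => f j i + \sum_(j <- s) f j i).
  exact: (usumD (H j) IH).
by apply/funext => i; rewrite big_cons.
Qed.

Lemma usum_le (I : choiceType) (f : I -> R[i]) a (M : R) :
  usum f a -> (forall A : {fset I}, cabs (\sum_(i <- A) f i) <= M) ->
  cabs a <= M.
Proof.
move=> /usumP fa H; apply/ler_addgt0Pl => e e0.
have [A /(_ A (fsubset_refl _)) Ae] := fa e e0.
rewrite -(subrK (\sum_(i <- A) f i) a) (le_trans (ler_cabsD _ _))// lerD//.
exact: ltW.
Qed.

(** The sum is the supremum of the finite partial sums, which increase with the index set. *)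
Lemma real_usum (I : choiceType) (f : I -> R) (M : R) :
  (forall i, 0 <= f i) ->
  (forall A : {fset I}, \sum_(i <- A) f i <= M) ->
  exists l : R, usum (fun i => (f i)%:C%C) l%:C%C.
Proof.
move=> f0 fM; pose S := [set x | exists A : {fset I}, x = \sum_(i <- A) f i].
have hS : has_sup S.
  split; first by exists 0, fset0; rewrite big_seq_fset0.
  by exists M => x [A ->].
exists (sup S); apply/usumP => e e0.
have [x [A ->] xA] := sup_adherent e0 hS.
exists A => B AB; rewrite -(rmorph_sum (real_complex R)) -(rmorphB (real_complex R)) cabs_real.
have le1 : \sum_(i <- A) f i <= \sum_(i <- B) f i.
  rewrite (big_fsetID _ (mem A) B)/= (_ : [fset x in B | x \in A] = A).
    by rewrite lerDl sumr_ge0.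
  by apply/fsetP => i; rewrite !inE/=; case: (boolP (i \in A)) => [/(fsubsetP AB)->|_]; rewrite ?andbF.
have le2 : \sum_(i <- B) f i <= sup S by apply: sup_upper_bound => //; exists B.
by rewrite ger0_norm ?subr_ge0// ltrBlDr -ltrBlDl (lt_le_trans xA).
Qed.

Lemma usum_ex (I : choiceType) (f : I -> R[i]) (M : R) :
  (forall A : {fset I}, \sum_(i <- A) cabs (f i) <= M) ->
  exists l, usum f l.
Proof.
move=> fM.
(* A real family u is the difference of the nonnegative ones |u| + u and |u|. *)
have part (u : I -> R) : (forall i, `|u i| <= cabs (f i)) ->
    exists l, usum (fun i => (u i)%:C%C) l.
  move=> uf.
  have uM (A : {fset I}) : \sum_(i <- A) `|u i| <= M.
    by rewrite (le_trans _ (fM A))// ler_sum.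
  have [l1 h1] := real_usum (fun i => normr_ge0 (u i)) uM.
  have [||l2 h2] := @real_usum _ (fun i => `|u i| + u i) (2 * M).
  - by move=> i; have := ler_norm (- u i); rewrite normrN; lra.
  - move=> A; rewrite big_split /= mulr_natl mulr2n lerD//.
    by rewrite (le_trans _ (uM A))// ler_sum// => i _; exact: ler_norm.
  exists (l2%:C%C + (-1) * l1%:C%C).
  have := usumD h2 (usumZ (c := -1) h1); congr usum; apply/funext => i.
  by rewrite mulN1r -rmorphB /= addrAC subrr add0r.
have [l1 h1] := part _ (fun i => ler_Re_cabs (f i)).
have [l2 h2] := part _ (fun i => ler_Im_cabs (f i)).
exists (l1 + ('i)%C * l2); have := usumD h1 (usumZ (c := ('i)%C) h2).
by congr usum; apply/funext => i; rewrite -complexE.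
Qed.

(** Unordered convergence bounds all finite partial sums at once. Applied to the indices where the
    real (or imaginary) part has a constant sign, this bound turns into one on the sum of absolute
    values. *)
Lemma usum_abs (I : choiceType) (f : I -> R[i]) l :
  usum f l -> exists M : R, forall A : {fset I}, \sum_(i <- A) cabs (f i) <= M.
Proof.
move=> /usumP /(_ 1 ltr01)[A Al].
pose K := cabs l + 1 + \sum_(i <- A) cabs (f i).
have fK (B : {fset I}) : cabs (\sum_(i <- B) f i) <= K.
  (* Adding [A] to [B] brings the partial sum within 1 of [l]; the correction only involves terms of
     [A], whence the constant [K]. *)
  have -> : \sum_(i <- B) f i = l - (l - \sum_(i <- A `|` B) f i)
      - \sum_(i <- A `\` B) f i.
    rewrite (big_fsetID _ (mem B) (A `|` B))/=.
    rewrite (_ : [fset x in A `|` B | x \in B] = B); last first.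
      by apply/fsetP => i; rewrite !inE /=; case: (i \in B); rewrite ?orbT ?andbF.
    rewrite (_ : [fset x in A `|` B | x \notin B] = A `\` B); last first.
      by apply/fsetP => i; rewrite !inE /=; case: (i \in B); rewrite ?orbT ?andbF ?orbF ?andbT.
    set x := \sum_(i <- B) _; set y := \sum_(i <- A `\` B) _.
    by rewrite opprB addrCA subrr addr0 addrK.
  rewrite (le_trans (ler_cabsB _ _))// lerD//.
    by rewrite (le_trans (ler_cabsB _ _))// lerD// ltW// Al// fsubsetUl.
  rewrite (le_trans (ler_cabs_sum _ _ _))//.
  rewrite [leRHS](big_fsetID _ (mem B) A)/= addrC.
  rewrite (_ : [fset x in A | x \notin B] = A `\` B); last first.
    by apply/fsetP => i; rewrite !inE /= andbC.
  by rewrite lerDl sumr_ge0// => i _; exact: cabs_ge0.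
(* Here [g] is the real or the imaginary part; splitting [B] by the sign of [g (f i)] gives two
   partial sums, each at most [K] in modulus. *)
have part (g : R[i] -> R) : {morph g : x y / x + y} -> g 0 = 0 ->
    (forall x, `|g x| <= cabs x) ->
    forall B : {fset I}, \sum_(i <- B) `|g (f i)| <= K + K.
  move=> gD g0 gle B; rewrite (big_fsetID _ (fun i => 0 <= g (f i)) B) /=.
  apply: lerD.
    rewrite (eq_big_seq (fun i => g (f i))); last first.
      by move=> i; rewrite !inE /= => /andP[_ /ger0_norm].
    by rewrite -(big_morph g gD g0) (le_trans (ler_norm _))// (le_trans (gle _)).
  rewrite (eq_big_seq (fun i => - g (f i))); last first.
    by move=> i; rewrite !inE /= -ltNge => /andP[_ /ltr0_norm].
  rewrite sumrN -(big_morph g gD g0) (le_trans (ler_norm _))// normrN.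
  by rewrite (le_trans (gle _)).
exists ((K + K) + (K + K)) => B.
apply: (le_trans (ler_sum _ (fun i _ => ler_cabs_ReIm (f i)))).
rewrite big_split lerD//.
- by apply: part => //; [case=> ? ? []|exact: ler_Re_cabs].
- by apply: part => //; [case=> ? ? []|exact: ler_Im_cabs].
Qed.

(** Since [f] vanishes off the image of [h], the sum over [J] can be computed on [I]. It serves to
    shift multi-indices in a differentiated series. *)
Lemma usum_reindex (I J : choiceType) (h : I -> J) (g : J -> I) (f : J -> R[i]) l :
  cancel h g -> (forall j, f j != 0 -> h (g j) = j) ->
  usum f l -> usum (f \o h) l.
Proof.
move=> hK gK /usumP H; apply/usumP => e /H[A Ae].
exists [fset g j | j in A] => B AB.
have -> : \sum_(i <- B) (f \o h) i = \sum_(j <- A `|` [fset h i | i in B]) f j.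
  have -> : \sum_(i <- B) (f \o h) i = \sum_(j <- [fset h i | i in B]) f j.
    by rewrite big_imfset//= => x y _ _; exact: (can_inj hK).
  apply: big_fset_incl; first exact: fsubsetUr.
  move=> j; rewrite !inE => /orP[jA|->//] /negP jB.
  apply/eqP; apply: contra_notT jB => /gK jE.
  apply/imfsetP; exists (g j) => //=; apply: (fsubsetP AB).
  by apply/imfsetP; exists j.
by apply: Ae; exact: fsubsetUl.
Qed.

End usum.

(** * Power series along lines *)

Section dominated_polynomials.
Context {R : realType}.
Implicit Types (p q : {poly R[i]}) (P Q : {poly R}).

Definition dominated p P := forall k, cabs p`_k <= P`_k.

Lemma dominatedM p P q Q :
  dominated p P -> dominated q Q -> dominated (p * q) (P * Q).
Proof.
move=> pP qQ k; rewrite !coefM (le_trans (ler_cabs_sum _ _ _))// ler_sum// => i _.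
by rewrite cabsM ler_pM ?cabs_ge0.
Qed.

Lemma dominated1 : dominated 1 1.
Proof.
move=> k; rewrite !coef1; case: (k == 0)%N; last by rewrite cabs0.
by rewrite cabs1.
Qed.

Lemma dominatedX p P k : dominated p P -> dominated (p ^+ k) (P ^+ k).
Proof.
move=> pP; elim: k => [|k IH]; first by rewrite !expr0; exact: dominated1.
by rewrite !exprS; exact: dominatedM.
Qed.

Lemma dominated_prod (I : Type) (s : seq I) (f : I -> {poly R[i]})
  (g : I -> {poly R}) : (forall i, dominated (f i) (g i)) ->
  dominated (\prod_(i <- s) f i) (\prod_(i <- s) g i).
Proof.
move=> fg; elim/big_rec2: _ => [|i y x _ h]; first exact: dominated1.
exact: dominatedM.
Qed.

Lemma dominated_affine (w v : R[i]) :
  dominated (w%:P + v *: 'X) ((cabs w)%:P + cabs v *: 'X).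
Proof.
move=> k; rewrite !coefE; case: k => [|[|k]] /=.
- by rewrite !mulr0 !addr0.
- by rewrite !mulr1 !add0r.
- by rewrite !mulr0 !addr0 cabs0.
Qed.

Lemma dominated_coef1 p P (tau : R) : dominated p P -> 0 < tau ->
  cabs p`_1 * tau <= P.[tau].
Proof.
move=> pP t0.
rewrite (@horner_coef_wide _ (maxn (size P) 2)) ?leq_maxl//.
have h2 : (1 < maxn (size P) 2)%N by rewrite leq_max orbT.
rewrite (bigD1 (Ordinal h2))//= expr1 -[leLHS]addr0 lerD//.
  by rewrite ler_wpM2r// ltW.
rewrite sumr_ge0// => i _; rewrite mulr_ge0 ?exprn_ge0 ?(ltW t0)//.
by rewrite (le_trans (cabs_ge0 _) (pP i)).
Qed.

(** In degree k at least 2, passing from [tau] to [t] gains the factor (|t| / tau)^k, which is at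
    most its square; the two lowest terms of [P.[tau]] are simply dropped. *)
Lemma dominated_taylor p P (tau : R) t : dominated p P -> 0 < tau ->
  cabs t <= tau ->
  cabs (p.[t] - p`_0 - t * p`_1) <= P.[tau] * (cabs t / tau) ^+ 2.
Proof.
move=> pP t0 tt; set m := maxn (size p) (size P).
have hp : (size p <= m.+2)%N by rewrite !leqW// leq_maxl.
have hP : (size P <= m.+2)%N by rewrite !leqW// leq_maxr.
have P0 k : 0 <= P`_k by rewrite (le_trans (cabs_ge0 _) (pP k)).
rewrite (horner_coef_wide _ hp) (horner_coef_wide _ hP) !big_ord_recl/=.
rewrite !expr0 !mulr1 /bump /= !expr1.
have cancel2 (x y S : R[i]) : x + (y * t + S) - x - t * y = S by ring.
rewrite cancel2.
set q := cabs t / tau.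
have q0 : 0 <= q by rewrite divr_ge0 ?cabs_ge0 ?(ltW t0).
have q1 : q <= 1 by rewrite ler_pdivrMr// mul1r.
have tq : cabs t = tau * q by rewrite mulrC divfK// gt_eqF.
have q20 := sqr_ge0 q.
rewrite mulrDl; apply: ler_wpDl; first exact: mulr_ge0.
rewrite mulrDl; apply: ler_wpDl; first by apply: mulr_ge0 => //; rewrite mulr_ge0// ltW.
rewrite mulr_suml (le_trans (ler_cabs_sum _ _ _))// ler_sum// => i _.
rewrite cabsM cabsX -mulrA ler_pM ?cabs_ge0 ?exprn_ge0 ?cabs_ge0// tq.
rewrite exprMn ler_wpM2l ?exprn_ge0 ?(ltW t0)//.
by rewrite addnA exprD ler_piMr// exprn_ile1.
Qed.

End dominated_polynomials.

(** Leibniz's rule at the origin. With [uniq s], the condition [i != j] removes exactly one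
    factor. *)
Lemma coef1_prod (R : comNzRingType) (I : eqType) (s : seq I) (f : I -> {poly R}) :
  uniq s ->
  (\prod_(i <- s) f i)`_1 =
  \sum_(j <- s) (f j)`_1 * \prod_(i <- s | i != j) (f i)`_0.
Proof.
elim: s => [|x s IH] /=; first by rewrite !big_nil coef1.
case/andP=> xs us; rewrite !big_cons eqxx /=.
rewrite coefM big_ord_recl big_ord_recl big_ord0 addr0 /= subn0 subnn (IH us) addrC.
congr (_ * _ + _).
  rewrite coef0_prod big_seq [RHS]big_seq_cond; apply: eq_bigl => i.
  by case: (boolP (i \in s)) => //= is_; apply/esym; apply: contraNneq xs => <-.
rewrite mulr_sumr; apply: eq_big_seq => j js; rewrite big_cons.
have -> : x != j by apply: contraNneq xs => ->.
exact: mulrCA.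
Qed.

Lemma coef0_affineX (R : comNzRingType) (w v : R) k :
  ((w%:P + v *: 'X) ^+ k)`_0 = w ^+ k.
Proof. by rewrite -horner_coef0 !hornerE ?mulr0 ?addr0. Qed.

Lemma coef1_affineX (R : comNzRingType) (w v : R) k :
  ((w%:P + v *: 'X) ^+ k)`_1 = v * (w ^+ k.-1 *+ k).
Proof.
have : ((w%:P + v *: 'X) ^+ k)^`()`_0 = v * (w ^+ k.-1 *+ k).
  rewrite deriv_exp coefMn mulrC coef0M coef0_affineX derivD derivC derivZ derivX.
  by rewrite add0r coefZ coef1 mulr1 mulrnAr mulrC.
by rewrite coef_deriv mulr1n.
Qed.

(** * Local expansions and directional derivatives of analytic functions *)

Section power_series.
Context {R : realType} {n : nat}.
Implicit Types (z w v b : 'rV[R[i]]_n) (F : 'rV[R[i]]_n -> R[i])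
  (a : {ffun 'I_n -> nat}) (c : {ffun 'I_n -> nat} -> R[i]).

Definition monom a w : R[i] := \prod_(j < n) w 0 j ^+ a j.

(** The formal partial derivative of [monom a]. The truncated predecessor at [a j = 0] is harmless,
    because the factor [*+ a j] is then zero. *)
Definition dmonom (j : 'I_n) a w : R[i] :=
  (w 0 j ^+ (a j).-1 *+ a j) * \prod_(k < n | k != j) w 0 k ^+ a k.

Definition line_poly a w v : {poly R[i]} :=
  \prod_(j < n) ((w 0 j)%:P + v 0 j *: 'X) ^+ a j.

Lemma horner_line_poly a w v t : (line_poly a w v).[t] = monom a (w + t *: v).
Proof.
rewrite horner_prod; apply: eq_bigr => j _.
by rewrite !hornerE !mxE (mulrC t).
Qed.

Lemma coef0_line_poly a w v : (line_poly a w v)`_0 = monom a w.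
Proof. by rewrite -horner_coef0 horner_line_poly scale0r addr0. Qed.

Lemma coef1_line_poly a w v :
  (line_poly a w v)`_1 = \sum_(j < n) v 0 j * dmonom j a w.
Proof.
rewrite coef1_prod ?index_enum_uniq//; apply: eq_bigr => j _.
rewrite coef1_affineX mulrA; congr (_ * _).
by apply: eq_bigr => k _; rewrite coef0_affineX.
Qed.

(* Coefficientwise domination by [P] with [P.[tau] <= s ^ |a|] plays the role of
   Cauchy's estimates on the disc of radius [tau]. *)
Lemma dominated_line_poly a w v (s tau : R) : 0 < tau ->
  (forall j, cabs (w 0 j) + tau * cabs (v 0 j) <= s) ->
  exists2 P, dominated (line_poly a w v) P & P.[tau] <= \prod_(j < n) s ^+ a j.
Proof.
move=> t0 wvs.
exists (\prod_(j < n) ((cabs (w 0 j))%:P + cabs (v 0 j) *: 'X) ^+ a j).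
  by apply: dominated_prod => j; apply: dominatedX; exact: dominated_affine.
rewrite horner_prod; apply: ler_prod => j _; rewrite !hornerE.
have h0 : 0 <= cabs (w 0 j) + cabs (v 0 j) * tau.
  by rewrite addr_ge0 ?mulr_ge0 ?cabs_ge0// ltW.
by rewrite exprn_ge0//= lerXn2r ?nnegrE// ?(le_trans h0)// (mulrC _ tau).
Qed.

(** A polydisc is used instead of a Euclidean ball because the single point with all coordinates [s]
    dominates every other one: [M] bounds the series of moduli there, hence everywhere on the
    polydisc. *)
Definition abs_expansion F z (s : R) c (M : R) : Prop :=
  [/\ 0 < s,
      forall A : {fset {ffun 'I_n -> nat}},
        \sum_(a <- A) cabs (c a) * \prod_(j < n) s ^+ a j <= M &
      forall w, (forall j, cabs (w 0 j) <= s) ->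
        usum (fun a => c a * monom a w) (F (z + w))].

Lemma enorm_sqr w : enorm w ^+ 2 = \sum_(j < n) cabs (w 0 j) ^+ 2.
Proof. by rewrite sqr_sqrtr// sumr_ge0// => j _; rewrite sqr_ge0. Qed.

Lemma enorm_ge0 w : 0 <= enorm w.
Proof. exact: sqrtr_ge0. Qed.

Lemma cabs_le_enorm w j : cabs (w 0 j) <= enorm w.
Proof.
rewrite -ler_sqr ?nnegrE ?cabs_ge0 ?enorm_ge0// enorm_sqr (bigD1 j)//= lerDl.
by rewrite sumr_ge0// => k _; rewrite sqr_ge0.
Qed.

(** The crude factor n in place of its square root is enough for comparing balls with polydiscs. *)
Lemma enorm_le w (s : R) : 0 <= s -> (forall j, cabs (w 0 j) <= s) ->
  enorm w <= s * n%:R.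
Proof.
move=> s0 ws; rewrite -ler_sqr ?nnegrE ?enorm_ge0 ?mulr_ge0// enorm_sqr.
apply: (@le_trans _ _ (\sum_(j < n) s ^+ 2)).
  by apply: ler_sum => j _; rewrite lerXn2r ?nnegrE ?cabs_ge0.
rewrite sumr_const card_ord exprMn -[leLHS]mulr_natr ler_wpM2l ?sqr_ge0//.
by rewrite -natrX ler_nat; case: n => // m; rewrite leq_pmull.
Qed.

(** With [s = rho / n.+1] the closed polydisc lies in the ball of convergence. Convergence at its
    corner is absolute by [usum_abs], and this provides [M]. *)
Lemma analytic_abs_expansion (U : set 'rV[R[i]]_n) F z : analytic_on U F -> U z ->
  exists s c M, abs_expansion F z s c M.
Proof.
move=> FU /FU[rho [c [rho0 H]]].
pose s := rho / n.+1%:R.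
have s0 : 0 < s by rewrite divr_gt0.
have wrho w : (forall j, cabs (w 0 j) <= s) -> enorm w < rho.
  move=> /(enorm_le (ltW s0)) /le_lt_trans; apply.
  by rewrite /s mulrAC -mulrA gtr_pMr// ltr_pdivrMr// mul1r ltr_nat.
have [|M HM] := @usum_abs _ _ _ _ (H (const_mx s%:C%C) _).
  by apply: wrho => j; rewrite mxE cabs_real gtr0_norm.
exists s, c, M; split => // [A|w ws]; last by apply: H; exact: wrho.
rewrite (le_trans _ (HM A))// ler_sum// => a _.
rewrite cabsM cabs_prod ler_wpM2l ?cabs_ge0// ler_prod// => j _.
by rewrite cabsX mxE cabs_real gtr0_norm// lexx exprn_ge0 ?(ltW s0).
Qed.

(** The remainder is the unordered sum of the remainders of the monomials restricted to the line;
    [dominated_taylor] bounds each of them, and the bounds add up to at most [M] times the common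
    quadratic factor. *)
Lemma abs_expansion_taylor F z s c M w v tau : abs_expansion F z s c M ->
  0 < tau -> (forall j, cabs (w 0 j) + tau * cabs (v 0 j) <= s) ->
  exists2 d, usum (fun a => c a * (line_poly a w v)`_1) d &
    forall t, cabs t <= tau ->
      cabs (F (z + w + t *: v) - F (z + w) - t * d) <= M * (cabs t / tau) ^+ 2.
Proof.
move=> [s0 cM cF] t0 wvs.
have line t : cabs t <= tau -> forall j, cabs ((w + t *: v) 0 j) <= s.
  move=> tt j; rewrite !mxE (le_trans (ler_cabsD _ _))// (le_trans _ (wvs j))//.
  by rewrite lerD// cabsM ler_wpM2r// cabs_ge0.
have [|d hd] := @usum_ex _ _ (fun a => c a * (line_poly a w v)`_1) (M / tau).
  move=> A; rewrite ler_pdivlMr// mulr_suml (le_trans _ (cM A))// ler_sum// => a _.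
  rewrite cabsM -mulrA ler_wpM2l ?cabs_ge0//.
  have [P aP Ps] := dominated_line_poly a t0 wvs.
  exact: le_trans (dominated_coef1 aP t0) Ps.
exists d => // t tt.
have F1 := cF _ (line t tt).
have F0 : usum (fun a => c a * monom a w) (F (z + w)).
  by apply: cF => j; have := line 0 _ j; rewrite scale0r addr0 cabs0; apply; exact: ltW.
have dF := usumD F1 (usumD (usumZ (c := -1) F0) (usumZ (c := - t) hd)).
rewrite -(addrA z) (_ : _ - _ - _ = F (z + (w + t *: v)) + (-1 * F (z + w) + - t * d)).
  2: by rewrite mulN1r mulNr -[LHS]addrA.
apply: (usum_le dF) => A.
rewrite (le_trans (ler_cabs_sum _ _ _))//.
rewrite (le_trans _ (ler_wpM2r _ (cM A))) ?exprn_ge0 ?divr_ge0 ?cabs_ge0 ?(ltW t0)//.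
rewrite mulr_suml ler_sum// => a _.
rewrite (_ : _ + _ = c a * ((line_poly a w v).[t] - (line_poly a w v)`_0
   - t * (line_poly a w v)`_1)); last first.
  by rewrite horner_line_poly coef0_line_poly; ring.
rewrite cabsM -mulrA ler_wpM2l ?cabs_ge0//.
have [P aP Ps] := dominated_line_poly a t0 wvs.
apply: le_trans (dominated_taylor aP t0 tt) _.
by rewrite ler_wpM2r// exprn_ge0 ?divr_ge0 ?cabs_ge0 ?(ltW t0).
Qed.

Lemma derive_taylor1 (F : 'rV[R[i]]_n -> R[i]) x v d (K tau : R) : 0 < tau ->
  (forall t, cabs t <= tau -> cabs (F (x + t *: v) - F x - t * d) <= K * cabs t ^+ 2) ->
  'D_v F x = d.
Proof.
move=> t0 H; apply: cvg_lim; first exact: norm_hausdorff.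
apply/pcvgP => e e0.
(* Below this radius the error [K * cabs h] of the difference quotient is less than [e]; the [+ 1]
   keeps the divisor positive. *)
pose dl := Num.min tau (e / (`|K| + 1)).
have dl0 : 0 < dl by rewrite lt_min t0 divr_gt0// ltr_wpDl.
have : \forall h \near (0 : R[i])^', `|h| < dl%:C%C.
  by apply: dnbhs0_lt; rewrite -[0]/(0%:C%C) ltcR.
have h0 := nbhs_dnbhs_neq (0 : R[i]).
apply: filterS2 h0 => h h0; rewrite cabsE ltcR lt_min => /andP[ht he].
have c0 : 0 < cabs h.
  by rewrite lt_neqAle cabs_ge0 andbT eq_sym; apply: contra_neq h0 => /cabs_eq0.
have := H h (ltW ht).
rewrite (_ : F (x + h *: v) - F x - h * d =
  - (h * (d - h^-1 *: (F (h *: v + x) - F x)))); last first.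
  by rewrite (addrC x) mulrBr [h * (_ *: _)]mulrA divff// mul1r opprB.
rewrite cabsN cabsM expr2 mulrCA ler_pM2l// => /le_lt_trans; apply.
apply: (@le_lt_trans _ _ ((`|K| + 1) * cabs h)).
  by rewrite ler_wpM2r ?cabs_ge0// (le_trans (ler_norm _))// lerDl.
by rewrite mulrC -ltr_pdivlMr// ltr_wpDl.
Qed.

(** The first order expansion in the coordinate direction [j]: halving the radius for [w] leaves
    room for a step of length [s / 2]. So partial derivatives may be taken term by term. *)
Lemma usum_partialz F z s c M w : abs_expansion F z s c M ->
  (forall j, cabs (w 0 j) <= s / 2) -> forall j,
  usum (fun a => c a * dmonom j a w) (partialz j F (z + w)).
Proof.
move=> Fs ws j; have [s0 _ _] := Fs.
have t0 : 0 < s / 2 by rewrite divr_gt0.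
have [|d hd H] := @abs_expansion_taylor _ _ _ _ _ w (delta_mx 0 j) _ Fs t0.
  move=> k; rewrite mxE eqxx /= (le_trans (lerD (ws k) (_ : _ <= s / 2)))//; last by lra.
  rewrite ger_pMr//; case: (k == j); last by rewrite cabs0.
  by rewrite cabs1.
have -> : partialz j F (z + w) = d.
  apply: (@derive_taylor1 _ _ _ _ (M / (s / 2) ^+ 2) (s / 2)) => // t /H /le_trans; apply.
  by rewrite exprMn exprVn mulrCA mulrC mulrA.
rewrite (_ : (fun a => _) = fun a => c a * (line_poly a w (delta_mx 0 j))`_1) //.
apply/funext => a; congr (_ * _).
rewrite coef1_line_poly (bigD1 j)//= big1 ?addr0; last first.
  by move=> k kj; rewrite mxE (negPf kj) andbF mul0r.
by rewrite mxE !eqxx mul1r.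
Qed.

Lemma abs_expansion_dderive F z s c M w b : abs_expansion F z s c M ->
  (forall j, cabs (w 0 j) <= s / 2) ->
  usum (fun a => c a * (line_poly a w b)`_1) (dderive b F (z + w)).
Proof.
move=> Fs ws.
have := usum_sum (s := index_enum 'I_n) (fun j => usumZ (c := b 0 j) (usum_partialz Fs ws (j := j))).
rewrite (_ : (fun _ => _) = fun a => c a * (line_poly a w b)`_1); last first.
  apply/funext => a; rewrite coef1_line_poly mulr_sumr; apply: eq_bigr => j _.
  by rewrite mulrCA.
by rewrite /dderive; congr usum; apply: eq_bigr => j _; rewrite mulrC.
Qed.

(** The linear coefficient of the expansion along [b] and [dderive b F z] are sums of the same
    family, hence equal. The choice of [tau] keeps [tau * cabs (b 0 j)] below [s]. *)
Lemma analytic_taylor1 (U : set 'rV[R[i]]_n) F z b : analytic_on U F -> U z ->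
  exists K tau : R, 0 < tau /\ forall t, cabs t <= tau ->
    cabs (F (z + t *: b) - F z - t * dderive b F z) <= K * cabs t ^+ 2.
Proof.
move=> FU Uz; have [s [c [M Fs]]] := analytic_abs_expansion FU Uz.
have [s0 _ _] := Fs.
pose tau := s / (enorm b + 1).
have b0 : 0 < enorm b + 1 by rewrite ltr_wpDl ?enorm_ge0.
have t0 : 0 < tau by rewrite divr_gt0.
have [|d hd H] := @abs_expansion_taylor _ _ _ _ _ 0 b _ Fs t0.
  move=> j; rewrite mxE cabs0 add0r /tau mulrAC ler_pdivrMr// ler_pM2l//.
  by rewrite (le_trans (cabs_le_enorm _ _))// lerDl.
have /(usum_unique hd) dE : usum (fun a => c a * (line_poly a 0 b)`_1) (dderive b F z).
  rewrite -[z in dderive _ _ z]addr0; apply: (abs_expansion_dderive Fs) => j.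
  by rewrite mxE cabs0 divr_ge0 ?ltW.
exists (M / tau ^+ 2), tau; split => // t /H.
by rewrite addr0 dE => /le_trans; apply; rewrite exprMn exprVn mulrCA mulrC mulrA.
Qed.

Definition shift_index (j : 'I_n) a : {ffun 'I_n -> nat} :=
  [ffun k => (a k + (k == j))%N].

Definition unshift_index (j : 'I_n) a : {ffun 'I_n -> nat} :=
  [ffun k => (a k - (k == j))%N].

Lemma dmonom_shift j a w : dmonom j (shift_index j a) w = (a j).+1%:R * monom a w.
Proof.
rewrite /dmonom /monom ffunE eqxx addn1 /= -mulr_natl -mulrA; congr (_ * _).
rewrite [RHS](bigD1 j)//=; congr (_ * _); apply: eq_bigr => k kj.
by rewrite ffunE (negPf kj) addn0.
Qed.

(** Termwise differentiation in the variable [j], reindexed by adding 1 to the exponent [a j], is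
    again a power series, with coefficients (a_j + 1) c_(a + e_j). *)
Lemma analytic_dderive (U : set 'rV[R[i]]_n) F b :
  analytic_on U F -> analytic_on U (dderive b F).
Proof.
move=> FU z Uz; have [s [c [M Fs]]] := analytic_abs_expansion FU Uz.
have [s0 _ _] := Fs.
exists (s / 2), (fun a => \sum_(j < n) b 0 j * (c (shift_index j a) * (a j).+1%:R)).
split=> [|w ws]; first by rewrite divr_gt0.
have ws' j : cabs (w 0 j) <= s / 2 by rewrite ltW// (le_lt_trans (cabs_le_enorm _ _)).
have H j : usum (fun a => b 0 j * (c (shift_index j a) * dmonom j (shift_index j a) w))
    (b 0 j * partialz j F (z + w)).
  apply: usumZ; apply: (usum_reindex (h := shift_index j) (g := unshift_index j)
    _ _ (usum_partialz Fs ws' (j := j))).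
    by move=> a; apply/ffunP => k; rewrite !ffunE addnK.
  (* A multi-index outside the image of the shift has [a j = 0] and contributes a zero term, so the
     truncated subtraction in [unshift_index] does no harm. *)
  move=> a; rewrite /dmonom; case: (posnP (a j)) => [->|aj _].
    by rewrite mulr0n mul0r mulr0 eqxx.
  apply/ffunP => k; rewrite !ffunE; case: eqP => [->|_] /=; last by rewrite subn0 addn0.
  by rewrite subn1 addn1 prednK.
have dE : dderive b F (z + w) = \sum_(j < n) b 0 j * partialz j F (z + w).
  by apply: eq_bigr => j _; rewrite mulrC.
rewrite dE; set g := (X in partial_sum X).
suff -> : g = fun a => \sum_(j < n)
    b 0 j * (c (shift_index j a) * dmonom j (shift_index j a) w).
  exact: (usum_sum (s := index_enum 'I_n) H).
apply/funext => a; rewrite /g mulr_suml; apply: eq_bigr => j _.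
by rewrite dmonom_shift !mulrA.
Qed.

Lemma analytic_dderiven (U : set 'rV[R[i]]_n) F b k :
  analytic_on U F -> analytic_on U (dderiven b k F).
Proof.
move=> FU; elim: k => [|k IH]; first exact: FU.
exact: (@analytic_dderive _ _ b IH).
Qed.

End power_series.

(** * Differential inequalities *)

Section real_analysis.
Context {R : realType}.
Implicit Types (f d : R -> R).

Lemma scaleRE (x y : R) : x *: y = x * y. Proof. by []. Qed.

Lemma is_derive1_continuous f (x df : R) :
  is_derive x 1 f df -> {for x, continuous f}.
Proof.
by move=> [fx _]; apply: differentiable_continuous; exact/derivable1_diffP.
Qed.

(** At the first time [s] when positivity fails, all the functions are nonnegative and one of them
    vanishes. Its derivative there is positive by hypothesis, yet it was positive just before [s]: a
    contradiction. A finite family is treated at once because the hypothesis at a zero of one member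
    uses the sign of all the others. *)
Lemma barrier (m : nat) (d : 'I_m -> R -> R) (a r : R) : a <= r ->
  (forall k, 0 < d k a) ->
  (forall k, d k x @[x --> a^'+] --> d k a) ->
  (forall k t, a < t <= r -> exists2 d' : R, is_derive t 1 (d k) d' &
     (forall j, 0 <= d j t) -> d k t = 0 -> 0 < d') ->
  forall k, 0 < d k r.
Proof.
move=> ar da ca dd k0; rewrite ltNge; apply/negP => dr.
pose S := [set t | a <= t <= r /\ exists k, d k t <= 0].
have Sr : S r by split; [rewrite ar lexx|exists k0].
have lS : lbound S a by move=> t [/andP[]].
have hS : has_inf S by split; [exists r|exists a].
have infS t : S t -> inf S <= t by move=> St; apply: ge_inf => //; exists a.
set s := inf S.
have as_ : a <= s by apply: lb_le_inf => //; exists r.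
have sr : s <= r by exact: infS.
have pos t : a <= t -> t < s -> forall k, 0 < d k t.
  move=> at_ ts k; rewrite ltNge; apply/negP => dk.
  suff /infS : S t by rewrite leNgt ts.
  by split; [rewrite at_ (le_trans (ltW ts))|exists k].
(* Right continuity at [a] keeps the first failure away from the initial point, where no derivative
   is assumed. *)
have as' : a < s.
  have : \forall t \near a^'+, forall k, 0 < d k t.
    by apply: filter_forall => k; apply: (cvgr_gt (d k a)).
  move=> /nbhs_ballP[e /= e0 He].
  rewrite (@lt_le_trans _ _ (a + e))// ?ltrDl//; apply: lb_le_inf; first by exists r.
  move=> t [/andP[at_ _] [k dk]]; rewrite leNgt; apply/negP => tae.
  have := dk; rewrite leNgt => /negP; apply.
  move: at_; rewrite le_eqVlt => /orP[/eqP <-//|at_].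
  apply: He => //; rewrite /ball /= distrC gtr0_norm ?subr_gt0//.
  by rewrite ltrBlDl.
have cont k : {for s, continuous (d k)}.
  by have [|d' dd' _] := dd k s; [rewrite as'|exact: is_derive1_continuous dd'].
have left_pt (e : R) : 0 < e -> exists h, [/\ 0 < h, h < e & a <= s - h].
  move=> e0; exists (Num.min e (s - a) / 2).
  have m0 : 0 < Num.min e (s - a) by rewrite lt_min e0 subr_gt0.
  have : Num.min e (s - a) <= e by rewrite ge_min lexx.
  have : Num.min e (s - a) <= s - a by rewrite ge_min lexx orbT.
  by split; lra.
(* A negative value at [s] would persist slightly to the left of [s], where all members are
   positive. *)
have ds0 k : 0 <= d k s.
  rewrite leNgt; apply/negP => dk.
  have : \forall t \near s, d k t < 0 by apply: (cvgr_lt _ (cont k)).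
  move=> /nbhs_ballP[e /= e0 He].
  have [h [h0 he ah]] := left_pt _ e0.
  have := pos _ ah _ k; rewrite gtrBl => /(_ h0); apply/negP; rewrite -leNgt ltW//.
  by apply: He; rewrite /ball /= opprB addrC subrK gtr0_norm.
(* If all members were positive at [s], they would remain so a little beyond [s], and the infimum
   would be larger. *)
have [k dk] : exists k, d k s <= 0.
  apply: contrapT => /forallNP nd.
  have : \forall t \near s, forall k, 0 < d k t.
    apply: (@filter_forall _ _ (fun k t => 0 < d k t) (nbhs s)) => k; apply: (cvgr_gt _ (cont k)).
    by rewrite ltNge; apply/negP; exact: nd.
  move=> /nbhs_ballP[e /= e0 He].
  suff : s + e <= s by rewrite gerDl leNgt e0.
  apply: lb_le_inf; first by exists r.
  move=> t St; rewrite leNgt; apply/negP => tse; have := infS _ St => st.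
  case: St => _ [k]; rewrite leNgt => /negP; apply; apply: He.
  by rewrite /ball /= distrC ger0_norm ?subr_ge0// ltrBlDl.
have dk0 : d k s = 0 by apply/eqP; rewrite eq_le dk ds0.
have [|d' [dd' d'E] /(_ ds0 dk0) d'0] := dd k s; first by rewrite as'.
have : (fun h => h^-1 *: ((d k \o shift s) (h *: (1 : R)) - d k s)) @ 0^' --> d'.
  by rewrite -d'E; exact: dd'.
move=> /cvgr_gt /(_ _ d'0) /nbhs_ballP[e /= e0 He].
(* The difference quotient is tested with the negative increment [- h], where it is negative because
   [d k s = 0] and [d k (s - h) > 0]. *)
have [h [h0 he ah]] := left_pt _ e0.
have := He (- h); rewrite /ball /= sub0r opprK gtr0_norm// => /(_ he).
rewrite oppr_eq0 gt_eqF// => /(_ isT).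
rewrite dk0 subr0 [_ *: 1]mulr1 addrC [_ *: _]mulrC invrN mulrN oppr_gt0.
rewrite pmulr_llt0 ?invr_gt0//; apply/negP; rewrite -leNgt ltW// pos// gtrBl//.
Qed.

End real_analysis.

(** * Integrals as functions of their upper end *)

Section integrals.
Context {R : realType}.
Implicit Types (f : R -> R).
Notation mu := (@lebesgue_measure R).

Lemma integrable_half_open f (E t : R) : 0 < E -> {in `]0, E[, continuous f} ->
  f x @[x --> 0^'+] --> f 0 -> t < E ->
  mu.-integrable `[0, t] (EFin \o f).
Proof.
move=> E0 cf f0.
have pos s : 0 < s -> s < E -> mu.-integrable `[0, s] (EFin \o f).
  move=> s0 sE.
  apply: continuous_compact_integrable; first exact: segment_compact.
  apply/(continuous_within_itvP _ s0); split => //.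
    move=> x; rewrite in_itv /= => /andP[x0 xs]; apply: cf.
    by rewrite in_itv /= x0 (lt_trans xs).
  by apply: cvg_at_left_filter; apply: cf; rewrite in_itv /= s0.
(* For [t <= 0] the interval has at most one point and is contained in [[0, E / 2]]. *)
move=> tE; have [t0|t0] := leP t 0; last exact: pos.
apply: (integrableS _ _ _ (pos (E / 2) _ _)) => //; try lra.
by move=> x /=; rewrite !in_itv /= => /andP[-> xt] /=; lra.
Qed.

Lemma is_derive_integral f (E t : R) : {in `]0, E[, continuous f} ->
  f x @[x --> 0^'+] --> f 0 -> 0 < t < E ->
  is_derive t 1 (fun x => \int[mu]_(y in `[0, x]) f y) (f t).
Proof.
move=> cf f0 /andP[t0 tE].
(* A two-sided derivative at [t] requires integrability a little beyond [t], hence the midpoint of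
   [t] and [E]. *)
have [||||F1 F2] := @continuous_FTC1 _ f (BLeft 0) t ((t + E) / 2).
- by lra.
- by apply: (integrable_half_open _ cf f0); lra.
- by rewrite lte_fin.
- by apply: cf; rewrite in_itv /= t0.
by apply: DeriveDef => //; rewrite -derive1E.
Qed.

Lemma cvg_integral0 f (E : R) : 0 < E -> {in `]0, E[, continuous f} ->
  f x @[x --> 0^'+] --> f 0 ->
  (\int[mu]_(y in `[0, x]) f y) @[x --> 0^'+] --> (0 : R).
Proof.
move=> E0 cf f0; apply: cvg_at_right_filter.
apply: (@parameterized_integral_cvg_left _ 0 (E / 2)); first by lra.
by apply: (integrable_half_open _ cf f0); lra.
Qed.

(* The integrands of the theorem involve a two-sided derivative, which is
   arbitrary at the endpoint 0. *)
Lemma Rintegral_congr_open f g (t : R) : (forall x, 0 < x <= t -> f x = g x) ->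
  mu.-integrable `[0, t] (EFin \o g) ->
  \int[mu]_(x in `[0, t]) f x = \int[mu]_(x in `[0, t]) g x.
Proof.
move=> fg ig.
have sub : [set` `]0, t]] `<=` [set` `[0, t]].
  by move=> x; rewrite /= !in_itv /= => /andP[/ltW -> ->].
have ig' : mu.-integrable `]0, t] (EFin \o g) by apply: integrableS ig.
have E : {in [set` `]0, t]], EFin \o f =1 EFin \o g}.
  by move=> x; rewrite inE /= in_itv /= => xt; rewrite fg.
rewrite -Rintegral_itv_obnd_cbnd; last first.
  by apply: eq_integrable ig' => // x xt; rewrite E.
rewrite -[RHS]Rintegral_itv_obnd_cbnd//.
by apply: eq_Rintegral => x; rewrite inE /= in_itv /= => xt; rewrite fg.
Qed.

End integrals.

(** * Gronwall's inequality with factorial weights *)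

Section gronwall.
Context {R : realType}.

(* Both sides are compared through their squares, since [u k] need not be
   differentiable where it vanishes. *)
Lemma factorial_gronwall (N : nat) (u : nat -> R -> R) (l l' phi A : R -> R)
  (r h0 : R) : 0 <= r ->
  (forall k t, 0 <= u k t) ->
  (forall t, 0 <= t <= r -> 0 < l t) ->
  (forall t, 0 < t <= r -> is_derive t 1 l (l' t)) ->
  l x @[x --> 0^'+] --> l 0 ->
  (forall t, 0 < t <= r -> is_derive t 1 phi (A t)) ->
  phi 0 = 0 -> phi x @[x --> 0^'+] --> (0 : R) ->
  (forall t, 0 < t <= r ->
     (N + 1)%:R * l t + N%:R * (pospart (- l' t) / l t) <= A t) ->
  (forall k t, 0 <= t <= r -> exists2 q : R,
     is_derive t 1 (fun s => u k s ^+ 2) q & q <= 2 * u k t * u k.+1 t) ->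
  (forall t M, 0 <= t <= r -> 0 <= M ->
     (forall k, (k <= N)%N -> u k t <= M * (k`!%:R * l t ^+ k)) ->
     forall k, u k t <= M * (k`!%:R * l t ^+ k)) ->
  0 <= h0 ->
  (forall k, (k <= N)%N -> u k 0 <= h0 * (k`!%:R * l 0 ^+ k)) ->
  forall k, u k r <= h0 * expR (phi r) * (k`!%:R * l r ^+ k).
Proof.
move=> r0 u0 l0 dl cl dphi phi0 cphi hA du hu h00 init.
have rr : 0 <= r <= r by rewrite r0 lexx.
(* The closure hypothesis [hu] reduces the claim to the orders [k <= N], a finite family to which
   [barrier] applies. *)
apply: (hu) => //; first by rewrite mulr_ge0 ?expR_ge0.
move=> k kN.
pose w k t : R := k`!%:R * l t ^+ k.
have w0 j t : 0 <= t <= r -> 0 < w j t.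
  by move=> tr; rewrite mulr_gt0 ?exprn_gt0 ?l0// ltr0n fact_gt0.
(* The perturbation [e] enters twice: in the factor it makes the initial inequality strict, in the
   exponent it makes the growth rate strictly larger than [A]. *)
pose G (e t : R) := (h0 + e) * expR (phi t + e * t).
have G0 e t : 0 < e -> 0 < G e t by move=> e0; rewrite mulr_gt0 ?expR_gt0// ltr_wpDl.
have Gw0 e j t : 0 < e -> 0 <= t <= r -> 0 <= G e t * w j t.
  by move=> e0 tr; rewrite ltW// mulr_gt0 ?G0 ?w0.
pose d (e : R) (k : 'I_N.+1) t := (G e t * w k t) ^+ 2 - u k t ^+ 2.
have du' j t : 0 <= t <= r -> {for t, continuous (fun s => u j s ^+ 2)}.
  by move=> tr; have [q dq _] := du j t tr; exact: is_derive1_continuous dq.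
have main e : 0 < e -> u k r <= G e r * w k r.
  move=> e0; suff : 0 < d e (Ordinal (kN : (k < N.+1)%N)) r.
    rewrite /d /= subr_gt0 ltr_sqr ?nnegrE ?u0 ?Gw0//.
    exact: ltW.
  apply: (@barrier _ _ (d e) 0 r r0) => [j|j|j t /andP[t0 tr]].
  - rewrite subr_gt0 ltr_sqr ?nnegrE ?u0 ?Gw0 ?lexx//.
    rewrite (le_lt_trans (init j _))//; first by rewrite -ltnS.
    rewrite /G phi0 mulr0 addr0 expR0 mulr1 ltr_pM2r ?ltrDl//.
    by apply: w0; rewrite lexx.
  - apply: cvgB; last first.
      by apply: cvg_at_right_filter; apply: du'; rewrite lexx.
    rewrite expr2; under eq_fun do rewrite expr2.
    have cG : G e x @[x --> 0^'+] --> G e 0.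
      rewrite /G phi0; apply: cvgM; first exact: cvg_cst.
      apply: continuous_cvg; first exact: continuous_expR.
      apply: cvgD => //; apply: cvgM; first exact: cvg_cst.
      exact: cvg_at_right_filter.
    have cw : w j x @[x --> 0^'+] --> w j 0.
      apply: cvgM; first exact: cvg_cst.
      by elim: (nat_of_ord j) => [|i IH]; [rewrite expr0; under eq_fun do rewrite expr0; exact: cvg_cst|rewrite exprS; under eq_fun do rewrite exprS; exact: cvgM].
    by apply: cvgM; exact: cvgM.
  - have tr' : 0 < t <= r by rewrite t0.
    have tr2 : 0 <= t <= r by rewrite ltW.
    have [q dq qle] := du j t tr2.
    have lt0 := l0 t tr2.
    have dG : is_derive t 1 (G e) ((A t + e) * G e t).
      have dlin : is_derive t 1 (fun x => phi x + e * x) (A t + e).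
        apply: is_derive_eq (is_deriveD (dphi t tr') (is_deriveZ e (is_derive_id t 1))) _.
        by rewrite scaleRE mulr1.
      apply: is_derive_eq (is_deriveZ (h0 + e) (is_derive1_comp (is_derive_expR _) dlin)) _.
      by rewrite /G /= !scaleRE; ring.
    have dw : is_derive t 1 (w j) (j%:R * (l' t / l t) * w j t).
      have dX : is_derive t 1 (fun x => l x ^+ j) (j%:R * l t ^+ j.-1 * l' t).
        have := is_deriveX j (dl t tr'); rewrite (_ : l ^+ j = fun x => l x ^+ j)//.
        by apply/funext => x; elim: (nat_of_ord j) => // i IH; rewrite !exprS -IH.
      apply: is_derive_eq (is_deriveZ j`!%:R dX) _.
      rewrite /w scaleRE; case: (nat_of_ord j) => [|i]; first by rewrite !mul0r mulr0.
      rewrite /= exprS; field; exact: lt0r_neq0.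
    exists (2 * (G e t * w j t) ^+ 2 * (A t + e + j%:R * (l' t / l t)) - q).
      have dGw : is_derive t 1 (fun x => G e x * w j x)
          (G e t * w j t * (A t + e + j%:R * (l' t / l t))).
        apply: is_derive_eq (is_deriveM dG dw) _.
        by rewrite /= !scaleRE; ring.
      have dGw2 : is_derive t 1 (fun x => (G e x * w j x) ^+ 2)
          (2 * (G e t * w j t) ^+ 2 * (A t + e + j%:R * (l' t / l t))).
        apply: is_derive_eq (is_deriveM dGw dGw) _.
        by rewrite /= !scaleRE; ring.
      exact: is_deriveB.
    move=> dge0 dj0.
    have ule i : (i <= N)%N -> u i t <= G e t * w i t.
      move=> iN; have := dge0 (Ordinal (iN : (i < N.+1)%N)).
      by rewrite /d /= subr_ge0 ler_sqr ?nnegrE ?u0 ?Gw0.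
    have uj : u j t = G e t * w j t.
      have /eqP := subr0_eq dj0; rewrite eqrXn2 ?u0 ?Gw0// => /eqP; exact: esym.
    (* The bounds for all orders up to [N] yield one for order [j.+1], including the case [j = N],
       where it comes only from [hu]. *)
    have uS : u j.+1 t <= G e t * w j t * (j.+1%:R * l t).
      have := hu t (G e t) tr2 (ltW (G0 _ _ e0)) ule j.+1.
      by rewrite /w factS natrM exprS => /le_trans; apply; rewrite le_eqVlt; apply/orP; left; apply/eqP; ring.
    rewrite subr_gt0 (le_lt_trans qle)// uj.
    have Gw : 0 < G e t * w j t by rewrite mulr_gt0 ?G0 ?w0.
    apply: (@le_lt_trans _ _ (2 * (G e t * w j t) * (G e t * w j t * (j.+1%:R * l t)))).
      by rewrite ler_wpM2l// mulr_ge0// ltW.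
    rewrite (_ : 2 * _ * _ = 2 * (G e t * w j t) ^+ 2 * (j.+1%:R * l t)); last by ring.
    rewrite ltr_pM2l; last by apply: mulr_gt0 => //; exact: exprn_gt0.
    (* What remains is (j + 1) l < A + e + j l' / l. Strictness comes from [e]; the rest follows
       from j <= N and from -l' / l <= (-l')^+ / l. *)
    apply: (@le_lt_trans _ _ (A t + j%:R * (l' t / l t))); last by lra.
    have := hA t tr'; set P := _ / _; set x := _ / _ => hAt.
    have xP : - x <= P by rewrite -mulNr ler_wpM2r ?invr_ge0 ?(ltW lt0)// le_max lexx.
    have P0 : 0 <= P by rewrite divr_ge0 ?(ltW lt0)// le_max lexx orbT.
    have jN : (j : nat)%:R <= N%:R :> R by rewrite ler_nat -ltnS.
    have h1 : j%:R * - x <= j%:R * P by rewrite ler_wpM2l.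
    have h2 : j%:R * P <= N%:R * P by rewrite ler_wpM2r.
    have h3 : j%:R * l t <= N%:R * l t by rewrite ler_wpM2r// ltW.
    move: hAt h1 h2 h3; rewrite natrD -natr1 mulrN mulrDl; lra.
have cG : G e r * w k r @[e --> 0^'+] --> h0 * expR (phi r) * w k r.
  apply: cvgM; last exact: cvg_cst.
  have -> : h0 * expR (phi r) = (h0 + 0) * expR (phi r + 0 * r).
    by rewrite mul0r !addr0.
  apply: cvgM.
    by apply: cvgD; [exact: cvg_cst|exact: cvg_at_right_filter].
  apply: continuous_cvg; first exact: continuous_expR.
  apply: cvgD; first exact: cvg_cst.
  by apply: cvgM; [exact: cvg_at_right_filter|exact: cvg_cst].
rewrite -/(w k r) leNgt; apply/negP => lt_u.
have nlt : \forall e \near 0^'+, G e r * w k r < u k r by apply: (cvgr_lt _ cG).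
have [e [Ge e0]] : exists e : R, G e r * w k r < u k r /\ 0 < e.
  by apply: (@filter_ex _ (0 : R)^'+); exact: (filterI nlt (nbhs_right_gt 0)).
by have := main e e0; rewrite leNgt Ge.
Qed.

End gronwall.

(** * Rays in the unit ball *)

Section rays.
Context {R : realType} {n : nat}.
Implicit Types (z b : 'rV[R[i]]_n) (F : 'rV[R[i]]_n -> R[i]) (theta t : R).

Lemma cabs_unit theta : cabs (cos theta +i* sin theta)%C = 1 :> R.
Proof. by rewrite /cabs /= cos2Dsin2 sqrtr1. Qed.

Lemma ray0 z b theta : ray z b theta 0 = z.
Proof. by rewrite /ray mul0r scale0r addr0. Qed.

Lemma rayD z b theta t h :
  ray z b theta (t + h) = ray z b theta t +
    (h%:C * (cos theta +i* sin theta))%C *: b.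
Proof. by rewrite /ray rmorphD mulrDl scalerDl addrA. Qed.

(** The coefficient [be] is the real inner product of [z] with the rotated direction. *)
Lemma enorm_ray_sqr z b theta : exists be : R, forall t,
  enorm (ray z b theta t) ^+ 2 = enorm b ^+ 2 * t ^+ 2 + 2 * be * t + enorm z ^+ 2.
Proof.
pose e j := (cos theta +i* sin theta)%C * b 0 j.
exists (\sum_(j < n) (complex.Re (z 0 j) * complex.Re (e j) +
                      complex.Im (z 0 j) * complex.Im (e j))) => t.
rewrite !enorm_sqr !mulr_suml mulr_sumr mulr_suml -!big_split /=.
apply: eq_bigr => j _.
have -> : cabs (b 0 j) = cabs (e j) by rewrite cabsM cabs_unit mul1r.
rewrite !mxE -mulrA -/(e j) !cabs_sqr.
by case: (z 0 j) (e j) => [x1 x2] [e1 e2] /=; rewrite !mul0r subr0 addr0; ring.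
Qed.

Lemma enorm_gt0 b : b != 0 -> 0 < enorm b.
Proof.
move=> b0; rewrite lt_neqAle enorm_ge0 andbT eq_sym; apply: contra_neq b0 => be0.
apply/rowP => j; rewrite mxE; apply: cabs_eq0; apply/eqP.
by rewrite eq_le cabs_ge0 andbT -be0 cabs_le_enorm.
Qed.

(** Along the ray the squared norm is a quadratic polynomial with value below 1 at 0, so it takes
    the value 1 at exactly one positive time. Factoring out this root bounds the distance to the
    sphere linearly in [E - r]. *)
Lemma exit_radius_spec z b theta : b != 0 -> uball z ->
  let E := exit_radius z b theta in
  0 < E /\ exists2 K : R, 0 < K & forall r, 0 <= r < E ->
    uball (ray z b theta r) /\ 1 - enorm (ray z b theta r) <= K * (E - r).
Proof.
move=> b0 zB; have [be q] := enorm_ray_sqr z b theta.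
have al0 : 0 < enorm b ^+ 2 by rewrite exprn_gt0// enorm_gt0.
have g1 : enorm z ^+ 2 < 1 by rewrite expr_lt1// enorm_ge0.
set al := enorm b ^+ 2 in q al0; set g := enorm z ^+ 2 in q g1.
have sqr1 t : enorm (ray z b theta t) = 1 <-> al * t ^+ 2 + 2 * be * t + g = 1.
  rewrite -q; split=> [->|/eqP]; first by rewrite expr1n.
  by rewrite sqrp_eq1 ?enorm_ge0// => /eqP.
have pos t : 0 < t -> al * t ^+ 2 + 2 * be * t + g = 1 -> 0 < al * t + 2 * be.
  move=> t0 h; rewrite -(pmulr_rgt0 _ t0).
  have -> : t * (al * t + 2 * be) = al * t ^+ 2 + 2 * be * t + g - g by ring.
  by rewrite h subr_gt0.
pose A := [set t : R | 0 < t /\ enorm (ray z b theta t) = 1].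
have [E0 E1] : A (exit_radius z b theta).
  suff [t [At lt]] : exists t, (A `&` lbound A) t.
    by rewrite /exit_radius -/A; case: (@xgetPex _ 0 (A `&` lbound A)); [exists t|].
  pose D := be ^+ 2 + al * (1 - g).
  have D0 : 0 < al * (1 - g) by rewrite mulr_gt0// subr_gt0.
  have Db : `|be| < Num.sqrt D.
    by rewrite -sqrtr_sqr ltr_sqrt ?ltrDl// ltr_wpDl// sqr_ge0.
  pose t := (Num.sqrt D - be) / al.
  have t0 : 0 < t by rewrite divr_gt0// subr_gt0 (le_lt_trans (ler_norm _)).
  have qt : al * t ^+ 2 + 2 * be * t + g = 1.
    have sD : Num.sqrt D ^+ 2 = D by rewrite sqr_sqrtr// addr_ge0 ?sqr_ge0// ltW.
    have -> : al * t ^+ 2 + 2 * be * t = (Num.sqrt D ^+ 2 - be ^+ 2) / al.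
      by rewrite /t; field; exact: lt0r_neq0.
    by rewrite sD /D; field; exact: lt0r_neq0.
  exists t; split; first by split=> //; exact/sqr1.
  (* Two roots 0 < s < t are excluded: the difference quotient of the quadratic between them would
     be positive. *)
  move=> s [s0 /sqr1 qs]; rewrite leNgt; apply/negP => st.
  have h1 := pos _ t0 qt.
  have : (t - s) * (al * t + 2 * be + al * s) =
      al * t ^+ 2 + 2 * be * t + g - (al * s ^+ 2 + 2 * be * s + g) by ring.
  rewrite qt qs subrr.
  by apply/eqP; rewrite gt_eqF// mulr_gt0 ?subr_gt0// addr_gt0// mulr_gt0.
set E := exit_radius z b theta in E0 E1 *.
split=> //; have qE := (sqr1 _).1 E1; have h1 := pos _ E0 qE.
(* The constant is the cofactor of [E - r] in 1 - |.|^2, evaluated at [r = E], where it is largest;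
   moreover 1 - x <= 1 - x^2 on [0, 1]. *)
have K0 : 0 < al * E + (al * E + 2 * be) by rewrite addr_gt0// mulr_gt0.
exists (al * E + (al * E + 2 * be)) => // r /andP[r0 rE].
have dq : 1 - enorm (ray z b theta r) ^+ 2 = (al * r + (al * E + 2 * be)) * (E - r).
  have -> : (al * r + (al * E + 2 * be)) * (E - r) =
      al * E ^+ 2 + 2 * be * E + g - (al * r ^+ 2 + 2 * be * r + g) by ring.
  by rewrite qE q.
have ar : al * r <= al * E by rewrite ler_pM2l// ltW.
have rB : uball (ray z b theta r).
  have : 0 < 1 - enorm (ray z b theta r) ^+ 2.
    by rewrite dq mulr_gt0 ?subr_gt0// ltr_wpDl// mulr_ge0// ltW.
  by rewrite subr_gt0 expr_lt1 ?enorm_ge0.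
split=> //; apply: (@le_trans _ _ (1 - enorm (ray z b theta r) ^+ 2)).
  rewrite lerD2l lerN2 expr2 -[leRHS]mul1r ler_wpM2r ?enorm_ge0//.
  exact: ltW.
by rewrite dq ler_wpM2r ?subr_ge0 ?(ltW rE)// lerD2r.
Qed.

Lemma is_derive_quadratic (g : R -> R) (t c K tau : R) : 0 < tau ->
  (forall h, `|h| <= tau -> `|g (t + h) - g t - h * c| <= K * h ^+ 2) ->
  is_derive t 1 g c.
Proof.
move=> tau0 H.
suff lim : (fun h => h^-1 *: ((g \o shift t) (h *: (1 : R)) - g t)) @ 0^' --> c.
  by apply: DeriveDef; [apply/cvg_ex; exists c|exact/cvg_lim].
apply/cvgrPdist_lt => e e0.
pose dl := Num.min tau (e / (`|K| + 1)).
have dl0 : 0 < dl by rewrite lt_min tau0 divr_gt0// ltr_wpDl.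
have hdl : \forall h \near (0 : R)^', `|h| < dl by exact: dnbhs0_lt.
have h0 := nbhs_dnbhs_neq (0 : R).
apply: filterS2 hdl h0 => h; rewrite lt_min => /andP[ht he] h0.
have hp : 0 < `|h| by rewrite normr_gt0.
rewrite -(ltr_pM2l hp) -normrM.
have -> : h * (c - h^-1 *: ((g \o shift t) (h *: 1) - g t)) = - (g (t + h) - g t - h * c).
  rewrite /= !scaleRE mulr1 mulrBr mulrA divff// mul1r (addrC h).
  by rewrite [RHS]opprB.
rewrite normrN (le_lt_trans (H h (ltW ht)))//.
rewrite -(real_normK (num_real h)) expr2 mulrCA ltr_pM2l//.
apply: (@le_lt_trans _ _ ((`|K| + 1) * `|h|)).
  by rewrite ler_wpM2r// (le_trans (ler_norm _))// lerDl.
by rewrite mulrC -ltr_pdivlMr// ltr_wpDl.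
Qed.

(** The left side is the real part of the product of [y] with the conjugate of [x]. *)
Lemma Re_mul_conj_le (x y : R[i]) :
  complex.Re x * complex.Re y + complex.Im x * complex.Im y <= cabs x * cabs y.
Proof.
have : cabs (conjc x) = cabs x by case: x => u v; rewrite /cabs /= sqrrN.
move=> <-; rewrite -cabsM; apply: le_trans (le_trans (ler_norm _) (ler_Re_cabs _)).
by case: x y => [u v] [u' v'] /=; rewrite mulNr opprK.
Qed.

(** The squared modulus is differentiable even at zeros of [F], as the sum of the squares of the
    real and imaginary parts. The rotation in the direction has modulus 1 and drops out of the
    bound. *)
Lemma is_derive_cabs_sqr_ray (U : set 'rV[R[i]]_n) F z b theta t :
  analytic_on U F -> U (ray z b theta t) ->
  exists2 q : R, is_derive t 1 (fun s => cabs (F (ray z b theta s)) ^+ 2) q &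
    q <= 2 * cabs (F (ray z b theta t)) * cabs (dderive b F (ray z b theta t)).
Proof.
move=> FU Ut; have [K [tau [tau0 H]]] := analytic_taylor1 b FU Ut.
set d := (cos theta +i* sin theta)%C; set w := ray z b theta t in Ut H *.
pose D := d * dderive b F w.
have near (p : R[i] -> R) : (forall x, `|p x| <= cabs x) ->
    {morph p : x y / x - y} -> (forall (h : R) x, p (h%:C%C * x) = h * p x) ->
    is_derive t 1 (fun s => p (F (ray z b theta s))) (p D).
  move=> ple pB pM; apply: (@is_derive_quadratic _ _ _ K tau tau0) => h hh.
  rewrite -pM -!pB rayD (le_trans (ple _))//.
  have := H (h%:C * d)%C; rewrite cabsM cabs_real (cabs_unit theta) mulr1 -mulrA.
  by rewrite real_normK ?num_real//; exact.
have dRe : is_derive t 1 (fun s => complex.Re (F (ray z b theta s))) (complex.Re D).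
  by apply: near => [||h [u v]]; [exact: ler_Re_cabs|case=> ? ? []|rewrite /= mul0r subr0].
have dIm : is_derive t 1 (fun s => complex.Im (F (ray z b theta s))) (complex.Im D).
  by apply: near => [||h [u v]]; [exact: ler_Im_cabs|case=> ? ? []|rewrite /= mul0r addr0].
exists (2 * (complex.Re (F w) * complex.Re D + complex.Im (F w) * complex.Im D)).
  rewrite (_ : (fun s => _) = (fun s => complex.Re (F (ray z b theta s)) *
      complex.Re (F (ray z b theta s)) + complex.Im (F (ray z b theta s)) *
      complex.Im (F (ray z b theta s)))).
    apply: is_derive_eq (is_deriveD (is_deriveM dRe dRe) (is_deriveM dIm dIm)) _.
    by rewrite /= !scaleRE; ring.
  by apply/funext => s; rewrite cabs_sqr !expr2.
rewrite -mulrA ler_pM2l// (le_trans (Re_mul_conj_le _ _))//.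
by rewrite ler_wpM2l ?cabs_ge0// cabsM (cabs_unit theta) mul1r.
Qed.

End rays.

(** * Continuously differentiable functions on a half-open interval *)

Section continuously_differentiable.
Context {R : realType}.
Implicit Types (h g : R -> R) (E t : R).

Lemma C1_on_derive h E : C1_on [set r | 0 <= r < E] h ->
  exists g : R -> R, [/\
    {in `]0, E[, continuous g}, 0 < E -> g x @[x --> 0^'+] --> g 0,
    0 < E -> h x @[x --> 0^'+] --> h 0 &
    forall t, 0 < t < E -> is_derive t 1 h (g t)].
Proof.
move=> [g cg dh]; exists g.
have sub u : u < E -> {within `[0, u], continuous g}.
  move=> uE; apply: continuous_subspaceW cg => x /=; rewrite in_itv /= => /andP[-> xu].
  exact: le_lt_trans uE.
split.
- move=> x; rewrite in_itv /= => /andP[x0 xE].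
  have u0 : 0 < (x + E) / 2 by lra.
  have /(continuous_within_itvP _ u0)[+ _ _] : {within `[0, (x + E) / 2], continuous g} by apply: sub; lra.
  by apply; rewrite in_itv /= x0; lra.
- move=> E0; have u0 : 0 < E / 2 by lra.
  by have /(continuous_within_itvP _ u0)[] : {within `[0, E / 2], continuous g} by apply: sub; lra.
- move=> E0.
  (* Right continuity at 0 is read off the one-sided derivative, by writing [h s] as the quotient
     times [s - 0] plus [h 0]. *)
  have lim : (h s - h 0) / (s - 0) * (s - 0) + h 0 @[s --> 0^'+] --> g 0 * (0 - 0) + h 0.
    apply: cvgD; last exact: cvg_cst.
    apply: cvgM; last first.
      by apply: cvgB; [exact: cvg_at_right_filter|exact: cvg_cst].
    have h00 : [set r | 0 <= r < E] 0 by rewrite /= lexx.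
    apply: (cvg_trans _ (dh 0 h00)); apply: cvg_app => P wP.
    have xE : \forall x \near (0 : R), x < E by exact: lt_nbhsl.
    rewrite /at_right; apply: filterS2 xE wP => x xE wP x0.
    by apply: wP; rewrite ?gt_eqF//= xE ltW.
  rewrite subrr mulr0 add0r in lim.
  apply: (cvg_trans _ lim); apply: near_eq_cvg.
  have x0 : \forall x \near (0 : R)^'+, 0 < x by exact: nbhs_right_gt.
  by apply: filterS x0 => x x0; rewrite subr0 divfK ?gt_eqF// subrK.
- move=> t /andP[t0 tE].
  have It : [set r | 0 <= r < E] t by rewrite /= ltW.
  suff lim : (fun u => u^-1 *: ((h \o shift t) (u *: (1 : R)) - h t)) @ 0^' --> g t.
    by apply: DeriveDef; [apply/cvg_ex; exists (g t)|exact/cvg_lim].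
  rewrite (_ : (fun u => _) = (fun s => (h s - h t) / (s - t)) \o (fun u => u + t)).
    2: by apply/funext => u; rewrite /= !scaleRE mulr1 addrK mulrC.
  apply: (cvg_comp _ _ _ (dh t It)) => P wP.
  have [e /= e0 He] : nbhs_ball t [set x | x != t -> [set r | 0 <= r < E] x -> P x].
    by apply/nbhs_ballP.
  (* Increments smaller than both [t] and [E - t] stay in the interval, so there the relative
     derivative is the two-sided one. *)
  have m0 : 0 < Num.min e (Num.min t (E - t)) by rewrite !lt_min e0 t0 subr_gt0.
  apply/nbhs_ballP; exists (Num.min e (Num.min t (E - t))) => //= u.
  rewrite /ball /= sub0r normrN !lt_min => /and3P[ue ut uE] u0.
  apply: He.
  - by rewrite /ball /= opprD addrCA subrr addr0 normrN.
  - by rewrite -subr_eq0 addrK.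
  - by move: ut uE; rewrite !ltr_norml => /andP[? ?] /andP[? ?]; apply/andP; split; lra.
Qed.

End continuously_differentiable.

(** * Functions of bounded index *)

Section half_open_integrals.
Context {R : realType}.
Implicit Types (f l : R -> R) (E : R).
Notation mu := (@lebesgue_measure R).

Definition continuous_half_open E f : Prop :=
  {in `]0, E[, continuous f} /\ f x @[x --> 0^'+] --> f 0.

(** The barrier function has derivative 1 + (c l - f), which is positive beyond [r0]; the
    contribution of the initial segment goes into [C], uniformly in [r]. *)
Lemma integral_dominated f l E r0 c : 0 < r0 < E ->
  continuous_half_open E f -> continuous_half_open E l ->
  (forall t, r0 < t < E -> f t <= c * l t) ->
  exists C, forall r, r0 <= r < E ->
    \int[mu]_(y in `[0, r]) f y <= C + c * \int[mu]_(y in `[0, r]) l y.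
Proof.
move=> /andP[r00 r0E] [cf f0] [cl l0] fl.
pose Phi t := \int[mu]_(y in `[0, t]) f y; pose La t := \int[mu]_(y in `[0, t]) l y.
(* This normalisation gives the barrier function the value 1 at [r0]. *)
pose C0 := 1 + Phi r0 - c * La r0 - r0.
pose d (_ : 'I_1) t := C0 + t - Phi t + c * La t.
have dd k t : r0 <= t < E -> is_derive t 1 (d k) (1 - f t + c * l t).
  move=> /andP[r0t tE]; have t0E : 0 < t < E by rewrite (lt_le_trans r00).
  have dPhi : is_derive t 1 Phi (f t) := is_derive_integral cf f0 t0E.
  have dLa : is_derive t 1 La (l t) := is_derive_integral cl l0 t0E.
  apply: is_derive_eq (is_deriveD (is_deriveB (is_deriveD (is_derive_cst C0 t 1)
    (is_derive_id t 1)) dPhi) (is_deriveZ c dLa)) _.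
  by rewrite scaleRE add0r.
exists (C0 + E) => r /andP[r0r rE].
suff : 0 < d ord0 r by rewrite /d -/(Phi r) -/(La r); lra.
apply: (barrier r0r) => [k|k|k t /andP[r0t tr]].
- by rewrite /d /C0; lra.
- apply: cvg_at_right_filter; apply: is_derive1_continuous (dd k r0 _).
  by rewrite lexx.
- have tE := le_lt_trans tr rE.
  exists (1 - f t + c * l t); first by apply: dd; rewrite ltW.
  by move=> _ _; have := fl t; rewrite r0t tE => /(_ isT); lra.
Qed.

(** The integral is compared with c ln (E / (E - t)), the primitive of c / (E - t) vanishing at
    0. *)
Lemma integral_diverges l E c : 0 < E -> 0 < c -> continuous_half_open E l ->
  (forall t, 0 < t < E -> c / (E - t) < l t) ->
  forall M, exists2 r0, 0 < r0 < E & forall r, r0 <= r < E ->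
    M <= \int[mu]_(y in `[0, r]) l y.
Proof.
move=> E0 c0 [cl l0] lc M.
pose La t := \int[mu]_(y in `[0, t]) l y.
have dln t : t < E -> is_derive t 1 (fun x => ln (E - x)) (- (E - t)^-1).
  move=> tE; have Et : 0 < E - t by rewrite subr_gt0.
  have dsub : is_derive t 1 (fun x => E - x) (- 1).
    apply: is_derive_eq (is_deriveB (is_derive_cst E t 1) (is_derive_id t 1)) _.
    by rewrite sub0r.
  by have := @is_derive1_comp _ (@ln R) (fun x => E - x) t _ _ (is_derive1_ln Et) dsub; rewrite mulrN1.
pose d (_ : 'I_1) t := La t + c * ln (E - t) + (1 - c * ln E).
have lower r : 0 <= r < E -> 0 < d ord0 r.
  move=> /andP[r0 rE]; apply: (barrier r0) => [k|k|k t /andP[t0 tr]].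
  - rewrite /d subr0 /La set_itv1 Rintegral_set1; lra.
  - apply: cvgD; last exact: cvg_cst.
    apply: cvgD; first by rewrite /La set_itv1 Rintegral_set1; exact: (cvg_integral0 E0 cl l0).
    apply: cvgM; first exact: cvg_cst.
    by apply: cvg_at_right_filter; apply: is_derive1_continuous (dln 0 E0).
  - have tE := le_lt_trans tr rE; have t0E : 0 < t < E by rewrite t0.
    exists (l t - c / (E - t)); last by move=> _ _; rewrite subr_gt0 lc.
    have dLa : is_derive t 1 La (l t) := is_derive_integral cl l0 t0E.
    apply: is_derive_eq (is_deriveD (is_deriveD dLa (is_deriveZ c (dln t tE)))
      (is_derive_cst (1 - c * ln E) t 1)) _.
    by rewrite scaleRE addr0 mulrN.
(* Past [E - E * expR (- x)] the logarithm of E / (E - r) is at least [x], so the integral exceeds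
   [c * x - 1], which is the absolute value of [M]. *)
pose x := (`|M| + 1) / c.
have x0 : 0 < x by rewrite divr_gt0// ltr_wpDl.
exists (E - E * expR (- x)).
  have : 0 < expR (- x) < 1 by rewrite expR_gt0 expR_lt1 oppr_lt0.
  by move=> /andP[e0 e1]; rewrite subr_gt0 ltrBlDr ltrDl mulr_gt0// gtr_pMr// e1.
move=> r /andP[r0r rE].
have xle : ln (E - r) <= ln E - x.
  have Er : 0 < E - r by rewrite subr_gt0.
  rewrite -ler_expR lnK ?posrE// expRD lnK ?posrE//; lra.
have r0 : 0 <= r.
  apply: le_trans r0r; rewrite subr_ge0 ger_pMr//.
  by rewrite -expR0 ler_expR oppr_le0 ltW.
have := lower r; rewrite r0 rE /d => /(_ isT).
have : c * ln (E - r) <= c * (ln E - x) by rewrite ler_pM2l.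
have : c * x = `|M| + 1 by rewrite /x mulrC divfK// gt_eqF.
by have := ler_norm M; rewrite -/(La r) mulrBr; lra.
Qed.

Definition growth_rate (N : nat) l l' t : R :=
  (N + 1)%:R * l t + N%:R * (pospart (- l' t) / l t).

(** The filter is arbitrary so as to cover both interior points and the right limit at 0. *)
Lemma cvg_growth_rate (N : nat) l l' (G : set_system R) {FG : Filter G} (x : R) :
  0 < l x -> l y @[y --> G] --> l x -> l' y @[y --> G] --> l' x ->
  growth_rate N l l' y @[y --> G] --> growth_rate N l l' x.
Proof.
move=> lx0 lx l'x; apply: cvgD; first by apply: cvgM => //; exact: cvg_cst.
apply: cvgM; first exact: cvg_cst.
apply: cvgM; last by apply: cvgV => //; rewrite gt_eqF.
rewrite /pospart maxr_absE; under eq_fun do rewrite maxr_absE.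
apply: cvgM; last exact: cvg_cst.
apply: cvgD; last by apply: cvg_norm; apply: cvgB; [exact: cvgN|exact: cvg_cst].
by apply: cvgD; [exact: cvgN|exact: cvg_cst].
Qed.

End half_open_integrals.

(** * Growth of the normalised coefficients along a ray *)

Section bounded_index.
Context {R : realType} {n : nat}.
Implicit Types (z b : 'rV[R[i]]_n) (F : 'rV[R[i]]_n -> R[i])
  (L : 'rV[R[i]]_n -> R).

(** A least admissible bound exists by well-ordering, so the default value of [xget] does not
    occur. *)
Lemma lindex_boundP b F L :
  bounded_lindex b F L -> lindex_bound b F L (lindex b F L).
Proof.
move=> [m0 hm0]; suff : exists m, lindex_bound b F L m /\
    forall m', lindex_bound b F L m' -> (m <= m')%N.
  by rewrite /lindex => hm; have [] := xgetPex 0%N hm.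
have ex : exists m, `[< lindex_bound b F L m >] by exists m0; exact/asboolP.
by case: (ex_minnP ex) => m /asboolP hm min; exists m; split=> // m' /asboolP/min.
Qed.

Lemma lcoef_le b F L k z (M : R) : 0 < L z ->
  (lcoef b F L k z <= M) = (cabs (dderiven b k F z) <= M * (k`!%:R * L z ^+ k)).
Proof.
move=> Lz; have w0 : 0 < k`!%:R * L z ^+ k.
  by apply: mulr_gt0; [rewrite ltr0n fact_gt0|exact: exprn_gt0].
by rewrite /lcoef (ler_pdivrMl _ _ w0) (mulrC M).
Qed.

Lemma lcoef_ge0 b F L k z : 0 <= L z -> 0 <= lcoef b F L k z.
Proof. by move=> Lz; rewrite mulr_ge0 ?cabs_ge0// invr_ge0 mulr_ge0 ?exprn_ge0. Qed.

Lemma max_lcoef_ge0 b F L m z : 0 <= max_lcoef b F L m z.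
Proof. by apply/bigmax_geP; left. Qed.

Lemma lcoef_le_max b F L m k z : (k <= m)%N ->
  lcoef b F L k z <= max_lcoef b F L m z.
Proof. by move=> km; apply/bigmax_geP; right; exists (Ordinal (km : (k < m.+1)%N)). Qed.

Lemma max_lcoef_le b F L m z (M : R) : 0 <= M ->
  (forall k, (k <= m)%N -> lcoef b F L k z <= M) -> max_lcoef b F L m z <= M.
Proof. by move=> M0 h; apply: bigmax_le => // i _; apply: h; rewrite -ltnS. Qed.

Lemma lcoef_ray_le b F L N z0 theta (g : R -> R) (r : R) :
  let l t := L (ray z0 b theta t) in let E := exit_radius z0 b theta in
  b != 0 -> (forall z, uball z -> 0 < L z) ->
  analytic_on uball F -> lindex_bound b F L N -> uball z0 ->
  continuous_half_open E l -> continuous_half_open E g ->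
  (forall t, 0 < t < E -> is_derive t 1 l (g t)) -> 0 <= r < E ->
  forall k, lcoef b F L k (ray z0 b theta r) <= max_lcoef b F L N z0 *
    expR (\int[lebesgue_measure]_(y in `[0, r]) growth_rate N l g y).
Proof.
move=> l E b0 L0 FB FN z0B [cl l0] [cg g0] dl /andP[r0 rE] k.
have [E0 [K K0 ball_ray]] := exit_radius_spec theta b0 z0B.
have lt0 t : 0 <= t < E -> 0 < l t by move=> /ball_ray[/L0].
have sub t : 0 <= t <= r -> 0 <= t < E by move=> /andP[-> /le_lt_trans]; exact.
have sub' t : 0 < t <= r -> 0 < t < E by move=> /andP[-> /le_lt_trans]; exact.
have cf : {in `]0, E[, continuous (growth_rate N l g)}.
  move=> x xE; apply: cvg_growth_rate; [|exact: cl|exact: cg].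
  by apply: lt0; move: xE; rewrite in_itv /= => /andP[/ltW -> ->].
have f0 : growth_rate N l g x @[x --> 0^'+] --> growth_rate N l g 0.
  by apply: cvg_growth_rate => //; apply: lt0; rewrite lexx.
have rB : uball (ray z0 b theta r) by have [] := ball_ray r; rewrite ?r0.
rewrite lcoef_le ?L0//.
apply: (@factorial_gronwall _ N (fun j t => cabs (dderiven b j F (ray z0 b theta t)))
  l g (fun t => \int[lebesgue_measure]_(y in `[0, t]) growth_rate N l g y)
  (growth_rate N l g)) => //.
- by move=> *; exact: cabs_ge0.
- by move=> t /sub; exact: lt0.
- by move=> t /sub'; exact: dl.
- by move=> t /sub'; exact: is_derive_integral.
- by rewrite set_itv1 Rintegral_set1.
- exact: (cvg_integral0 E0).
- move=> j t /sub /ball_ray[tB _].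
  have [q dq qle] := is_derive_cabs_sqr_ray (analytic_dderiven b j FB) tB.
  by exists q.
(* Bounded index is exactly the closure hypothesis: a common bound on the normalised coefficients of
   order at most [N] passes to every order. *)
- move=> t M /sub /ball_ray[tB _] M0 uM j; have lt := L0 _ tB.
  rewrite -lcoef_le// (le_trans (FN j _ tB))// max_lcoef_le// => i iN.
  by rewrite lcoef_le// uM.
- exact: max_lcoef_ge0.
- by move=> j jN; rewrite /l ray0 -lcoef_le ?L0// lcoef_le_max.
Qed.

End bounded_index.

(** * Logarithmic form of the estimates and the upper limit *)

Lemma lne_le_lnD {R : realType} (x y a : R) : 0 <= x -> x <= y * expR a ->
  (lne x%:E <= lne y%:E + a%:E)%E.
Proof.
rewrite le_eqVlt => /orP[/eqP <- _|x0 xy]; first by rewrite le0_lneNy// leNye.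
have y0 : 0 < y by rewrite -(pmulr_lgt0 _ (expR_gt0 a)) (lt_le_trans x0).
rewrite !lne_EFin// -EFinD lee_fin -[a in leRHS]expRK -lnM ?posrE ?expR_gt0//.
by rewrite ler_ln ?posrE ?mulr_gt0 ?expR_gt0.
Qed.

Lemma limf_esup_le {R : realType} (f : R -> \bar R) (G : set_system R)
  (M : \bar R) : (\forall x \near G, f x <= M)%E ->
  (limf_esup f G <= M)%E.
Proof.
move=> fM; rewrite limf_esupE; apply: ge_ereal_inf.
exists (ereal_sup (f @` [set x | (f x <= M)%E])); first by exists [set x | (f x <= M)%E].
by apply: ge_ereal_sup => _ [x /= fx <-].
Qed.

Theorem theorem14 (R : realType) (n : nat) (b : 'rV[R[i]]_n) (hb : b != 0)
  (beta : R) (hbeta : 1 < beta)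
  (L : 'rV[R[i]]_n -> R)
  (L_cont : {within uball, continuous L})
  (L_gt0 : forall z, uball z -> 0 < L z)
  (L_gt : forall z, uball z -> beta * enorm b / (1 - enorm z) < L z)
  (L_C1 : forall z0, uball z0 -> forall theta : R, 0 <= theta <= 2 * pi ->
     C1_on [set r : R | 0 <= r < exit_radius z0 b theta]
           (fun r => L (ray z0 b theta r)))
  (F : 'rV[R[i]]_n -> R[i])
  (F_analytic : analytic_on uball F)
  (F_bounded : bounded_lindex b F L)
  (N : nat) (hN : N = lindex b F L) :
  (forall z0, uball z0 -> forall theta : R, 0 <= theta <= 2 * pi ->
   forall r : R, 0 <= r < exit_radius z0 b theta -> forall p : nat,
     (lne (lcoef b F L p (ray z0 b theta r))%:E <=
      lne (max_lcoef b F L N z0)%:E +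
      (\int[lebesgue_measure]_(t in `[0%R, r])
         ((N + 1)%:R * L (ray z0 b theta t) +
          N%:R * (pospart (- ray_derive L z0 b theta t) /
                  L (ray z0 b theta t)))%R)%R%:E)%E)
  /\
  ((forall z0, uball z0 ->
     forall eps : R, 0 < eps -> exists2 delta : R, 0 < delta &
       forall theta r : R, 0 <= theta <= 2 * pi ->
         0 <= r < exit_radius z0 b theta ->
         1 - delta < enorm (ray z0 b theta r) ->
         pospart (- ray_derive L z0 b theta r) / L (ray z0 b theta r) ^+ 2
           < eps) ->
   forall z0, uball z0 -> forall theta : R, 0 <= theta <= 2 * pi ->
     (limf_esup (fun r : R =>
        lne (cabs (F (ray z0 b theta r)))%:E /
        (\int[lebesgue_measure]_(t in `[0%R, r]) L (ray z0 b theta t))%R%:E)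
        (exit_radius z0 b theta)^'- <= (N + 1)%:R%:E)%E).
Proof.
have FN : lindex_bound b F L N by rewrite hN; exact: lindex_boundP.
have ray_facts z0 (z0B : uball z0) theta (ht : 0 <= theta <= 2 * pi) :
    exists g : R -> R, [/\
      continuous_half_open (exit_radius z0 b theta) (fun t => L (ray z0 b theta t)),
      continuous_half_open (exit_radius z0 b theta) g,
      forall t, 0 < t < exit_radius z0 b theta ->
        is_derive t 1 (fun t => L (ray z0 b theta t)) (g t) &
      forall t, 0 < t < exit_radius z0 b theta -> ray_derive L z0 b theta t = g t].
  have [E0 _] := exit_radius_spec theta hb z0B.
  have [g [cg g0 l0 dl]] := C1_on_derive (L_C1 z0 z0B theta ht).
  exists g; split=> //.
  - split; last exact: l0.
    by move=> t; rewrite in_itv /= => /dl; exact: is_derive1_continuous.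
  - by split; last exact: g0.
  - by move=> t /dl dlt; rewrite /ray_derive derive1E derive_val.
split=> [z0 z0B theta ht r rE p|small z0 z0B theta ht].
  have [E0 [K K0 ball_ray]] := exit_radius_spec theta hb z0B.
  have [g [cl cg dl rdE]] := ray_facts z0 z0B theta ht.
  have [r0 rE'] := andP rE.
  have L0 t : 0 <= t < exit_radius z0 b theta -> 0 < L (ray z0 b theta t).
    by move=> /ball_ray[/L_gt0].
  rewrite (_ : \int[_]_(t in _) _ = \int[lebesgue_measure]_(t in `[0, r])
      growth_rate N (fun t => L (ray z0 b theta t)) g t).
    apply: lne_le_lnD; first by rewrite lcoef_ge0// ltW// L0.
    exact: lcoef_ray_le.
  apply: Rintegral_congr_open => [t /andP[t0 tr]|].
    by rewrite /growth_rate rdE// t0 (le_lt_trans tr).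
  apply: (integrable_half_open E0 _ _ rE') => [t tE|].
    apply: cvg_growth_rate; [|exact: cl.1|exact: cg.1].
    by apply: L0; move: tE; rewrite in_itv /= => /andP[/ltW -> ->].
  by apply: cvg_growth_rate; [rewrite L0// lexx|exact: cl.2|exact: cg.2].
have [E0 [K K0 ball_ray]] := exit_radius_spec theta hb z0B.
have [g [cl cg dl rdE]] := ray_facts z0 z0B theta ht.
set E := exit_radius z0 b theta in E0 K K0 ball_ray cl cg dl rdE *.
pose l t := L (ray z0 b theta t).
have L0 t : 0 <= t < E -> 0 < l t by move=> /ball_ray[/L_gt0].
apply/lee_addgt0Pr => eta eta0; rewrite -EFinD.
(* The error [eta] is shared among N + 1 equal parts: N for the terms with [pospart] and one for the
   additive constants. *)
pose e := eta / (N + 1)%:R.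
have N0 : 0 < (N + 1)%:R :> R by rewrite ltr0n addn1.
have e0 : 0 < e by rewrite divr_gt0.
have [delta delta0 Hdelta] := small z0 z0B e e0.
(* The first entry makes [r1] positive; the second forces K (E - t) < delta / 2 past [r1], so that
   the ray is within [delta] of the sphere. *)
pose r1 := Num.max (E / 2) (E - delta / (2 * K)).
have d0 : 0 < delta / (2 * K) by rewrite divr_gt0// mulr_gt0.
have r1E : 0 < r1 < E by rewrite lt_max gt_max; apply/andP; split; [apply/orP; left|apply/andP; split]; lra.
have f_le t : r1 < t < E -> growth_rate N l g t <= ((N + 1)%:R + N%:R * e) * l t.
  move=> /andP[r1t tE].
  have t0 : 0 < t by case/andP: r1E => /lt_trans ->.
  have tE' : 0 <= t < E by rewrite ltW.
  have lt := L0 t tE'.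
  have [_ near1] := ball_ray t tE'.
  have : 1 - delta < enorm (ray z0 b theta t).
    have : E - delta / (2 * K) < t by rewrite (le_lt_trans _ r1t)// le_max lexx orbT.
    have : K * (delta / (2 * K)) = delta / 2 by field; exact: lt0r_neq0.
    move=> KE h; have : K * (E - t) < K * (delta / (2 * K)) by rewrite ltr_pM2l//; lra.
    lra.
  move=> /(Hdelta theta t ht tE'); rewrite rdE ?t0// => small_t.
  rewrite /growth_rate mulrDl lerD2l -mulrA ler_wpM2l//.
  rewrite ler_pdivrMr// -mulrA -expr2 -ler_pdivrMr ?exprn_gt0//.
  exact: ltW.
have cf : continuous_half_open E (growth_rate N l g).
  split=> [t tE|]; last by apply: cvg_growth_rate; [rewrite L0// lexx|exact: cl.2|exact: cg.2].
  apply: cvg_growth_rate; [|exact: cl.1|exact: cg.1].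
  by apply: L0; move: tE; rewrite in_itv /= => /andP[/ltW -> ->].
have [C dom] := integral_dominated r1E cf cl f_le.
have div : forall M, exists2 r0, 0 < r0 < E & forall r, r0 <= r < E ->
    M <= \int[lebesgue_measure]_(y in `[0, r]) l y.
  have b1 := enorm_gt0 hb.
  apply: (@integral_diverges _ l E (beta * enorm b / K)) => //.
    by rewrite divr_gt0// mulr_gt0// (lt_trans ltr01).
  move=> t /andP[t0 tE]; have [tB near1] : uball (ray z0 b theta t) /\ 1 - enorm (ray z0 b theta t) <= K * (E - t).
    by apply: ball_ray; rewrite ltW.
  apply: le_lt_trans (L_gt _ tB); rewrite -(mulrA (beta * enorm b)) -invfM.
  rewrite ler_wpM2l ?mulr_ge0 ?(ltW b1) ?(ltW (lt_trans ltr01 hbeta))//.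
  by rewrite lef_pV2 ?posrE ?mulr_gt0 ?subr_gt0.
pose H := max_lcoef b F L N z0.
(* Past [r2] the integral of [l] is at least 1, so dividing by it is safe, and large enough for [e]
   times it to absorb [ln H + C]. *)
have [r2 /andP[r20 r2E] big] := div (Num.max 1 ((ln H + C) / e)).
apply: limf_esup_le.
have rr1 : \forall r \near E^'-, r1 < r by apply: nbhs_left_gt; case/andP: r1E.
have rr2 : \forall r \near E^'-, r2 < r by exact: nbhs_left_gt.
have rr3 : \forall r \near E^'-, r < E by exact: nbhs_left_lt.
apply: filterS3 rr1 rr2 rr3 => r rr1 rr2 rE.
have r0 : 0 <= r < E by rewrite rE andbT (le_trans _ (ltW rr2))// ltW.
have := big r; rewrite ltW// rE ge_max => /(_ isT) /andP[La1 LaC].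
have := dom r; rewrite ltW// rE => /(_ isT).
set La := \int[_]_(_ in _) l _ in La1 LaC *; set Phi := \int[_]_(_ in _) _ => PhiLa.
have La0 : 0 < La by rewrite (lt_le_trans ltr01).
rewrite -/La inver gt_eqF//.
have FH : cabs (F (ray z0 b theta r)) <= H * expR Phi.
  have := @lcoef_ray_le R n b F L N z0 theta g r hb L_gt0 F_analytic FN z0B cl cg dl r0 0%N.
  by rewrite /lcoef expr0 mulr1 invr1 mul1r.
(* At a zero of [F] the quotient is minus infinity; elsewhere [H] must be positive and real
   logarithms can be used. *)
have [->|F0] := eqVneq (cabs (F (ray z0 b theta r))) 0.
  by rewrite le0_lneNy// gt0_mulNye ?leNye// lte_fin invr_gt0.
have {}F0 : 0 < cabs (F (ray z0 b theta r)) by rewrite lt_neqAle eq_sym F0 cabs_ge0.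
have H0 : 0 < H by rewrite -(pmulr_lgt0 _ (expR_gt0 Phi)) (lt_le_trans F0).
rewrite lne_EFin// -EFinM lee_fin ler_pdivrMr//.
have : ln (cabs (F (ray z0 b theta r))) <= ln H + Phi.
  by rewrite -[Phi in leRHS]expRK -lnM ?posrE ?expR_gt0// ler_ln ?posrE ?mulr_gt0 ?expR_gt0.
have : ln H + C <= e * La by rewrite mulrC -ler_pdivrMr.
have eE : (N + 1)%:R * e = eta by rewrite mulrC divfK// gt_eqF.
have : (N + 1)%:R * e * La = eta * La by rewrite eE.
move: PhiLa; rewrite natrD !mulrDl mul1r; lra.
Qed.
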